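(* Let $f:\mathbb{R}\to\mathbb{R}$ be of bounded variation on $[-\infty,\infty]$ with $\lim_{|x|\to\infty}f(x)=0$. Then $\hat f(s)=\int_{-\infty}^{\infty}e^{-ist}f(t)\,dt$ exists for each real $s\neq0$. And, for each $x\in\mathbb{R}$, $$\frac{f(x-)+f(x+)}{2}=\frac{1}{2\pi}\lim_{\substack{T\to\infty\\ S\to0^+}}\int_{S<|s|<T}e^{ixs}\int_{-\infty}^{\infty}e^{-ist}f(t)\,dt\,ds.$$ Suppose moreover that the function $x\mapsto e^{-iax}f(x)$ is of bounded variation on $[-\infty,\infty]$ for some $a\in\mathbb{R}$. Then, for each $x\in\mathbb{R}$, $$\frac{f(x-)+f(x+)}{2}=\frac{1}{2\pi}\lim_{\substack{T\to\infty\\ S\to0^+}}\int_{S<|s-a|<T}e^{ixs}\int_{-\infty}^{\infty}e^{-ist}f(t)\,dt\,ds.$$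
   Context: $f(x-)$ and $f(x+)$ denote the left and right limits of $f$ at $x$. A (real- or complex-valued) function $h$ is of bounded variation on $[-\infty,\infty]$ if the sums $\sum_{n=1}^N|h(x_n)-h(x_{n-1})|$ are bounded over all partitions $-\infty=x_0<x_1<\dots<x_N=\infty$, where $h(\pm\infty)$ denotes $\lim_{t\to\pm\infty}h(t)$. The integral $\int_{-\infty}^\infty e^{-ist}f(t)\,dt$ is in general only conditionally convergent, and is understood as the improper integral $\lim_{A\to-\infty,\,B\to\infty}\int_A^B e^{-ist}f(t)\,dt$. The limits $T\to\infty$ and $S\to0^+$ are taken independently. *)

(* Defs.v *)
From Stdlib Require Import Reals.
From Coquelicot Require Import Coquelicot.
Open Scope R_scope.

Definition extend_Rbar {V : NormedModule R_AbsRing} (h : R -> V) (lm lp : V)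
    (x : Rbar) : V :=
  match x with
  | Finite r => h r
  | p_infty => lp
  | m_infty => lm
  end.

Definition bounded_variation_Rbar {V : NormedModule R_AbsRing} (h : R -> V) : Prop :=
  exists lm lp : V,
    filterlim h (Rbar_locally m_infty) (locally lm) /\
    filterlim h (Rbar_locally p_infty) (locally lp) /\
    exists M : R, forall (N : nat) (x : nat -> Rbar),
      x 0%nat = m_infty -> x N = p_infty ->
      (forall n : nat, (n < N)%nat -> Rbar_lt (x n) (x (S n))) ->
      sum_n_m (G := R_AbelianMonoid)
        (fun n => norm (minus (extend_Rbar h lm lp (x n))
                              (extend_Rbar h lm lp (x (pred n))))) 1 N <= M.

(* e^(i theta) *)
Definition expi (theta : R) : C := (cos theta, sin theta).

Definition fourier_integrand (f : R -> R) (s t : R) : C :=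
  Cmult (expi (- (s * t))) (RtoC (f t)).

(* The product of the two filters makes these improper integrals, with the two
   endpoints tending to infinity independently. The integrals over compact
   intervals are Riemann integrals of C-valued functions. *)
Definition ex_fourier (f : R -> R) (s : R) : Prop :=
  ex_RInt_gen (V := C_R_NormedModule) (fourier_integrand f s)
    (Rbar_locally m_infty) (Rbar_locally p_infty).

(* Only meaningful when [ex_fourier f s] holds. *)
Definition fourier (f : R -> R) (s : R) : C :=
  RInt_gen (V := C_R_CompleteNormedModule) (fourier_integrand f s)
    (Rbar_locally m_infty) (Rbar_locally p_infty).

(* [l] is the integral of [g] over S0 < |s - a| < T0 (for 0 < S0 < T0), that is,
   over the union of the intervals (a - T0, a - S0) and (a + S0, a + T0). *)
Definition is_RInt_annulus (g : R -> C) (a S0 T0 : R) (l : C) : Prop :=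
  exists l1 l2 : C,
    is_RInt (V := C_R_NormedModule) g (a - T0) (a - S0) l1 /\
    is_RInt (V := C_R_NormedModule) g (a + S0) (a + T0) l2 /\
    l = Cplus l1 l2.

(* [filterlimi] also asserts that the integrals exist for all large T0 and all
   small S0 > 0. *)
Definition is_lim_RInt_annulus (g : R -> C) (a : R) (L : C) : Prop :=
  filterlimi (fun TS : R * R => is_RInt_annulus g a (snd TS) (fst TS))
    (filter_prod (Rbar_locally p_infty) (at_right 0))
    (locally (T := C_R_NormedModule) L).

(* Main.v *)
Require Import Defs.
From Stdlib Require Import Reals Lra Lia PeanoNat Classical IndefiniteDescription.
From Coquelicot Require Import Coquelicot.
Open Scope R_scope.

(** Multiplying by [e^(ixs)] centres the Fourier integral at [x]: with
    [t = x + u] and [t = x - u] it becomes a combination of the half-line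
    integrals of [h(u) cos(su)] and [h(u) sin(su)], where [h] is [u |-> f(x+u)]
    or [u |-> f(x-u)]. The cosine part is even in [s] and the sine part odd, so
    only the cosine part survives the integration over [S < |s| < T]. Exchanging
    the two integrals turns [cos(su)] into its primitive in [s], and the theorem
    reduces to a statement about one half-line: the integral over [u > 0] of
    [h(u) (sin(Tu) - sin(Su)) / u] tends to [h(0+) PI/2]. Adding the two halves
    and doubling, for the two components of the annulus, gives
    [PI (f(x-) + f(x+))].

    All the estimates come from one inequality. If the oscillation of [h] on an
    interval is controlled by the increments of a function [W], and [Phi] is a
    primitive of [phi], then the integral of [h phi] differs from the boundary
    term of [h Phi] by at most [sup |Phi|] times the increment of [W]
    ([integration_by_parts_bound]). As the variation of [h] beyond [A] tends to
    [0], taking [phi(u) = cos(su + c)], whose primitive is at most [1/|s|],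
    gives the existence of the Fourier integral and its uniformity on
    [|s| >= S] ([half_line_transform_uniform]); this uniformity justifies the
    exchange of integrals ([half_line_transform_RInt],
    [truncated_transform_RInt]). Taking [phi(u) = sin(Tu)/u], whose primitive
    [Si(Tu)] is bounded uniformly in [T], gives the two limits: as [S] tends to
    [0] the contribution of a bounded interval is [O(S)] and that of the tail
    is small ([sinc_transform_small_frequency]); as [T] tends to infinity
    [Si(Tu)] is close to [PI/2] away from [u = 0], while near [0] the function
    [h] has small variation on the right of [0]
    ([sinc_transform_large_frequency]). The value [Si(oo) = PI/2] is read off
    the integral of [exp(-v z)] along a quarter of the unit circle
    ([is_derive_arc_integral]).

    For the annulus centred at [a], the frequency shift [s = a + r] replaces
    [f] by [e^(-iat) f(t)]. The real and imaginary parts of that function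
    satisfy the hypotheses of the centred case, and [e^(iax)] undoes the
    modulation in the limit ([fourier_inversion_annulus]). *)

(* Discharges by linear arithmetic the premises of a hypothesis. *)
Ltac feed H :=
  repeat match type of H with ?A -> _ => specialize (H ltac:(lra)) end.

(** * Control of functions of bounded variation *)

Definition partition_sum {E : NormedModule R_AbsRing} (h : R -> E) (lm lp : E)
    (xs : nat -> Rbar) (N : nat) : R :=
  sum_n_m (G := R_AbelianMonoid)
    (fun n => norm (minus (extend_Rbar h lm lp (xs n))
                          (extend_Rbar h lm lp (xs (pred n))))) 1 N.

Definition increasing_upto (xs : nat -> Rbar) (N : nat) : Prop :=
  forall n : nat, (n < N)%nat -> Rbar_lt (xs n) (xs (S n)).

Definition append_point (xs : nat -> Rbar) (N : nat) (z : Rbar) (n : nat) : Rbar :=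
  if Nat.leb n N then xs n else z.

Lemma append_point_increasing (xs : nat -> Rbar) (N : nat) (z : Rbar) :
  increasing_upto xs N -> Rbar_lt (xs N) z ->
  increasing_upto (append_point xs N z) (S N).
Proof.
  intros Hi Hz n Hn. unfold append_point.
  destruct (Nat.leb_spec n N); [|lia].
  destruct (Nat.leb_spec (S n) N).
  - apply Hi; lia.
  - replace n with N by lia. exact Hz.
Qed.

Lemma append_point_sum {E : NormedModule R_AbsRing} (h : R -> E) (lm lp : E)
    (xs : nat -> Rbar) (N : nat) (z : Rbar) :
  partition_sum h lm lp (append_point xs N z) (S N) =
  partition_sum h lm lp xs N +
  norm (minus (extend_Rbar h lm lp z) (extend_Rbar h lm lp (xs N))).
Proof.
  unfold partition_sum. rewrite sum_n_Sm by lia.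
  apply (f_equal2 Rplus).
  - apply sum_n_m_ext_loc. intros k Hk. unfold append_point.
    destruct (Nat.leb_spec k N); [|lia].
    destruct (Nat.leb_spec (pred k) N); [|lia]. reflexivity.
  - unfold append_point. simpl pred.
    destruct (Nat.leb_spec (S N) N); [lia|].
    destruct (Nat.leb_spec N N); [|lia]. reflexivity.
Qed.

(** The variation on [(-oo, x]], the supremum of the partition sums that end at
    [x], controls the increments: appending a point [y] to a partition that ends
    at [x] adds [|h y - h x|] to its sum. Appending [+oo] bounds every such sum
    by the total variation. *)
Lemma bounded_variation_control {E : NormedModule R_AbsRing} (h : R -> E) :
  bounded_variation_Rbar h ->
  exists (V : R -> R) (M : R),
    (forall x y, x <= y -> norm (minus (h y) (h x)) <= V y - V x) /\
    (forall x, Rabs (V x) <= M).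
Proof.
  intros (lm & lp & _ & _ & M & HM).
  set (P := fun x v => exists N xs, xs 0%nat = m_infty /\ xs N = Finite x /\
      increasing_upto xs N /\ v = partition_sum h lm lp xs N).
  assert (Hpos : forall x v, P x v -> 0 <= v).
  { intros x v (N & xs & _ & _ & _ & ->). unfold partition_sum.
    assert (H0 : forall k, 0 <= sum_n_m (G := R_AbelianMonoid)
      (fun n => norm (minus (extend_Rbar h lm lp (xs n))
                 (extend_Rbar h lm lp (xs (pred n))))) 1 k).
    { induction k.
      - rewrite sum_n_m_zero by lia. apply Rle_refl.
      - rewrite sum_n_Sm by lia. apply Rplus_le_le_0_compat; [exact IHk|].
        apply norm_ge_0. }
    apply H0. }
  assert (Hbd : forall x v, P x v -> v <= M).
  { intros x v (N & xs & H0 & HN & Hi & ->).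
    assert (H := HM (S N) (append_point xs N p_infty)).
    change (sum_n_m _ 1 (S N)) with
      (partition_sum h lm lp (append_point xs N p_infty) (S N)) in H.
    rewrite append_point_sum in H.
    assert (Hn := norm_ge_0 (minus (extend_Rbar h lm lp p_infty)
                             (extend_Rbar h lm lp (xs N)))).
    eapply Rle_trans; [|apply H].
    - apply Rle_trans with (partition_sum h lm lp xs N + 0); [lra|].
      apply Rplus_le_compat_l. exact Hn.
    - exact H0.
    - unfold append_point. destruct (Nat.leb_spec (S N) N); [lia|reflexivity].
    - apply append_point_increasing; [exact Hi|]. rewrite HN. exact I. }
  assert (Hne : forall x, exists v, P x v).
  { intros x.
    exists (partition_sum h lm lp (fun n => match n with O => m_infty | _ => Finite x end) 1).
    exists 1%nat, (fun n => match n with O => m_infty | _ => Finite x end).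
    repeat split. intros n Hn. replace n with 0%nat by lia. exact I. }
  assert (Hstep : forall x y v, x < y -> P x v -> P y (v + norm (minus (h y) (h x)))).
  { intros x y v Hxy (N & xs & H0 & HN & Hi & ->).
    exists (S N), (append_point xs N y). repeat split.
    - exact H0.
    - unfold append_point. destruct (Nat.leb_spec (S N) N); [lia|reflexivity].
    - apply append_point_increasing; [exact Hi|]. rewrite HN. exact Hxy.
    - rewrite append_point_sum, HN. reflexivity. }
  assert (Hlub : forall x, exists V : R, is_lub (P x) V).
  { intros x. destruct (completeness (P x)) as [V HV].
    - exists M. intros v Hv. exact (Hbd x v Hv).
    - apply Hne.
    - exists V. exact HV. }
  apply functional_choice in Hlub. destruct Hlub as [V HV].
  exists V, M. split.
  - intros x y Hxy. destruct (Rle_lt_or_eq_dec x y Hxy) as [Hlt|<-].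
    + assert (V x <= V y - norm (minus (h y) (h x))); [|lra].
      apply (HV x). intros v Hv.
      assert (H := proj1 (HV y) _ (Hstep x y v Hlt Hv)). lra.
    + rewrite (minus_eq_zero (h x)), Rminus_diag. apply Req_le, norm_zero.
  - intros x. destruct (Hne x) as [v Hv].
    rewrite Rabs_pos_eq.
    + apply (HV x). intros w Hw. exact (Hbd x w Hw).
    + apply Rle_trans with v; [exact (Hpos x v Hv)|]. exact (proj1 (HV x) v Hv).
Qed.

(** [V] is any majorant of the variation rather than the variation itself, so
    that products and translates of controlled functions are controlled by
    explicit formulas. *)
Definition controlled (f V : R -> R) (a b : R) : Prop :=
  forall x y, a <= x -> x <= y -> y <= b -> Rabs (f y - f x) <= V y - V x.

(** * Riemann integrability of controlled functions *)

(** Let [p] be the supremum of the points before which [V] has increased by at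
    most [eps]. Then [f] is within [eps] of a constant on [(a, p)], and on
    [(p, b)] the remaining increase of [V] is smaller by [eps], which is the
    induction step. The hypotheses are on the open interval because [V] may
    jump at [p]. *)
Lemma step_approximation (f V : R -> R) (eps : R) (N : nat) : 0 <= eps -> forall a b : R,
  a <= b ->
  (forall x y, a < x -> x <= y -> y < b -> Rabs (f y - f x) <= V y - V x) ->
  (forall x y, a < x -> x <= y -> y < b -> V y - V x <= INR N * eps) ->
  exists g : R -> R, ex_RInt g a b /\
    forall t, a < t < b -> Rabs (f t - g t) <= eps.
Proof.
  intros Heps; induction N as [|N IH]; intros a b Hab Hf HV.
  - exists (fun _ => f ((a + b) / 2)). split; [apply ex_RInt_const|].
    intros t Ht. simpl in HV.
    destruct (Rle_dec t ((a + b) / 2)) as [Hm|Hm].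
    + assert (H1 := Hf t ((a + b) / 2)); feed H1. assert (H2 := HV t ((a + b) / 2)); feed H2.
      rewrite Rabs_minus_sym. lra.
    + assert (H1 := Hf ((a + b) / 2) t); feed H1. assert (H2 := HV ((a + b) / 2) t); feed H2.
      lra.
  - set (E := fun t => t = a \/
      (a < t < b /\ forall s, a < s <= t -> V t - V s <= eps)).
    destruct (completeness E) as [p [Hp1 Hp2]].
    { exists b. intros t [->|[? _]]; lra. }
    { exists a. left; reflexivity. }
    assert (Hap : a <= p) by (apply Hp1; left; reflexivity).
    assert (Hpb : p <= b) by (apply Hp2; intros t [->|[? _]]; lra).
    assert (Hlow : forall s t, a < s <= t -> t < p -> V t - V s <= eps).
    { intros s t Hs Ht.
      destruct (classic (exists t', E t' /\ t < t')) as [[t' [[->|[H1 H2]] Htt]]|Hn].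
      - lra.
      - assert (H3 := H2 s); feed H3. assert (H4 := Hf t t'); feed H4.
        assert (H5 := Rabs_pos (f t' - f t)). lra.
      - exfalso. apply (Rlt_not_le _ _ Ht). apply Hp2. intros t' Ht'.
        destruct (Rle_dec t' t); [assumption|]. exfalso. apply Hn.
        exists t'. split; [assumption|lra]. }
    destruct (IH p b Hpb) as (g & Hg1 & Hg2).
    { intros x y Hx Hxy Hy. apply Hf; lra. }
    { intros x y Hx Hxy Hy.
      apply Rnot_lt_le. intros Hlt.
      apply (Rlt_not_le _ _ Hx). apply Hp1. right. split; [lra|].
      intros s Hs. assert (H := HV s y); feed H. rewrite S_INR in H.
      lra. }
    exists (fun t => if Rlt_dec t p then f ((a + p) / 2)
                     else if Req_dec_T t p then f p else g t).
    split.
    + apply ex_RInt_Chasles with p.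
      * apply ex_RInt_ext with (fun _ => f ((a + p) / 2)); [|apply ex_RInt_const].
        intros x. rewrite Rmin_left, Rmax_right by lra. intros Hx.
        destruct (Rlt_dec x p); [reflexivity|lra].
      * apply ex_RInt_ext with g; [|assumption].
        intros x. rewrite Rmin_left, Rmax_right by lra. intros Hx.
        destruct (Rlt_dec x p); [lra|]. destruct (Req_dec_T x p); [lra|reflexivity].
    + intros t Ht. destruct (Rlt_dec t p) as [H|H].
      * destruct (Rle_dec t ((a + p) / 2)) as [Hm|Hm].
        -- assert (H1 := Hf t ((a + p) / 2)); feed H1. assert (H2 := Hlow t ((a + p) / 2)); feed H2.
           rewrite Rabs_minus_sym. lra.
        -- assert (H1 := Hf ((a + p) / 2) t); feed H1. assert (H2 := Hlow ((a + p) / 2) t); feed H2.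
           lra.
      * destruct (Req_dec_T t p) as [->|Hne]; [|apply Hg2; lra].
        rewrite Rminus_diag, Rabs_R0. exact Heps.
Qed.

(** A uniform limit of integrable functions is integrable. *)
Lemma controlled_ex_RInt (f V : R -> R) (a b : R) :
  a <= b -> controlled f V a b -> ex_RInt f a b.
Proof.
  intros Hab Hf.
  (* The convergence theorem wants uniform convergence on the whole line, so
     everything is set to [0] outside [(a, b)]. *)
  set (cut := fun (u : R -> R) t =>
    if Rlt_dec a t then if Rlt_dec t b then u t else 0 else 0).
  assert (Hcut : forall u : R -> R, forall x, Rmin a b < x < Rmax a b -> u x = cut u x).
  { intros u x. rewrite Rmin_left, Rmax_right by lra. intros Hx. unfold cut.
    destruct (Rlt_dec a x); [|lra]. destruct (Rlt_dec x b); [reflexivity|lra]. }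
  assert (Hstep : forall n : nat, exists g : R -> R, ex_RInt g a b /\
    forall t, a < t < b -> Rabs (f t - g t) <= / (INR n + 1)).
  { intros n.
    assert (He : 0 < / (INR n + 1)) by (apply Rinv_0_lt_compat; pose proof (pos_INR n); lra).
    destruct (INR_unbounded ((V b - V a) / / (INR n + 1))) as [N HN].
    apply (step_approximation f V (/ (INR n + 1)) N (Rlt_le _ _ He) a b Hab).
    - intros; apply Hf; lra.
    - intros x y Hx Hxy Hy.
      apply Rlt_div_l in HN; [|assumption].
      assert (H1 := Hf a x); feed H1. assert (H2 := Hf y b); feed H2.
      assert (H3 := Rabs_pos (f x - f a)). assert (H4 := Rabs_pos (f b - f y)). lra. }
  apply functional_choice in Hstep. destruct Hstep as [g Hg].
  destruct (filterlim_RInt (V := R_CompleteNormedModule) (fun n => cut (g n)) a b eventually _ (cut f)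
     (fun n => RInt (cut (g n)) a b)) as [I [_ HI]].
  - intros n. apply (RInt_correct (V := R_CompleteNormedModule)).
    apply ex_RInt_ext with (g n); [apply Hcut|apply Hg].
  - apply filterlim_locally. intros eps.
    assert (Hl : is_lim_seq (fun n => / (INR n + 1)) 0).
    { apply (is_lim_seq_inv _ p_infty); [|discriminate].
      apply (is_lim_seq_plus _ _ p_infty 1);
        [apply is_lim_seq_INR|apply is_lim_seq_const|reflexivity]. }
    apply is_lim_seq_spec in Hl. specialize (Hl eps). revert Hl.
    apply filter_imp. intros n Hn t. rewrite Rminus_0_r in Hn.
    change (Rabs (cut (g n) t - cut f t) < eps). unfold cut.
    destruct (Rlt_dec a t); [destruct (Rlt_dec t b)|];
      try (rewrite Rminus_diag, Rabs_R0; apply cond_pos).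
    rewrite Rabs_minus_sym. eapply Rle_lt_trans; [apply Hg; lra|].
    eapply Rle_lt_trans; [apply Rle_abs|exact Hn].
  - exists I. apply is_RInt_ext with (cut f); [|exact HI].
    intros x Hx. symmetry. apply Hcut, Hx.
Qed.

(** The kernels [cos(su + c)] and [sin(Tu)/u] are all of this kind, on the whole
    line. *)
Definition bounded_lipschitz (phi : R -> R) (B L : R) : Prop :=
  (forall t, Rabs (phi t) <= B) /\
  (forall x y, Rabs (phi y - phi x) <= L * Rabs (y - x)).

Lemma controlled_sub (f V : R -> R) (a b c d : R) :
  controlled f V a b -> a <= c -> d <= b -> controlled f V c d.
Proof. intros Hf Hc Hd x y Hx Hxy Hy. apply Hf; lra. Qed.

Lemma controlled_bounded (f V : R -> R) (a b t : R) :
  controlled f V a b -> a <= t <= b -> Rabs (f t) <= Rabs (f a) + (V b - V a).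
Proof.
  intros Hf Ht.
  assert (H1 := Hf a t); feed H1. assert (H2 := Hf t b); feed H2.
  assert (H3 := Rabs_pos (f b - f t)).
  assert (H4 := Rabs_triang (f a) (f t - f a)).
  replace (f a + (f t - f a)) with (f t) in H4 by ring. lra.
Qed.

(** The product is controlled by [M L t + B V t], with [M] a bound of [f]. *)
Lemma ex_RInt_controlled_mult (f V phi : R -> R) (a b B L : R) :
  a <= b -> controlled f V a b -> bounded_lipschitz phi B L ->
  ex_RInt (fun t => f t * phi t) a b.
Proof.
  intros Hab Hf [HB HL].
  set (M := Rabs (f a) + (V b - V a)).
  apply (controlled_ex_RInt _ (fun t => M * L * t + B * V t) a b Hab).
  intros x y Hx Hxy Hy.
  replace (f y * phi y - f x * phi x)
    with (f y * (phi y - phi x) + phi x * (f y - f x)) by ring.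
  eapply Rle_trans; [apply Rabs_triang|]. rewrite !Rabs_mult.
  assert (H1 : Rabs (f y) <= M) by (apply controlled_bounded; [assumption|lra]).
  assert (H2 := HL x y). rewrite (Rabs_pos_eq (y - x)) in H2 by lra.
  assert (H3 := Hf x y); feed H3. assert (H4 := HB x).
  assert (H5 := Rmult_le_compat _ _ _ _ (Rabs_pos _) (Rabs_pos _) H1 H2).
  assert (H6 := Rmult_le_compat _ _ _ _ (Rabs_pos _) (Rabs_pos _) H4 H3). lra.
Qed.

Lemma bounded_lipschitz_continuous (phi : R -> R) (B L x : R) :
  bounded_lipschitz phi B L -> continuous phi x.
Proof.
  intros [_ HL]. apply filterlim_locally. intros eps.
  assert (HL0 : 0 <= L).
  { assert (H := HL 0 1). assert (H' := Rabs_pos (phi 1 - phi 0)).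
    rewrite Rminus_0_r, Rabs_R1 in H. lra. }
  assert (Hd : 0 < eps / (L + 1)) by (apply Rdiv_lt_0_compat; [apply cond_pos|lra]).
  exists (mkposreal _ Hd). intros y Hy.
  change (Rabs (y - x) < eps / (L + 1)) in Hy.
  change (Rabs (phi y - phi x) < eps).
  apply Rlt_div_r in Hy; [|lra].
  assert (H := HL x y). assert (H' := Rabs_pos (y - x)). nra.
Qed.

Lemma ex_RInt_bounded_lipschitz (phi : R -> R) (B L a b : R) :
  bounded_lipschitz phi B L -> ex_RInt phi a b.
Proof.
  intros H. apply (ex_RInt_continuous (V := R_CompleteNormedModule)).
  intros z _. exact (bounded_lipschitz_continuous phi B L z H).
Qed.

(** * Integration by parts against a function of bounded variation *)

Section SummationByParts.
Variables (f V phi Phi : R -> R) (a b B L K : R).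
Hypothesis Hf : controlled f V a b.
Hypothesis Hphi : bounded_lipschitz phi B L.
Hypothesis HPhi : forall t, a <= t <= b -> is_derive Phi t (phi t).
Hypothesis HK : forall t, a <= t <= b -> Rabs (Phi t) <= K.

Let defect (c d : R) : R :=
  RInt (fun t => f t * phi t) c d - (f d * Phi d - f c * Phi c).

(** Freezing [f] at [c] makes the integral explicit; the error is at most
    [B (d - c)] times the oscillation of [f]. The other term is
    [Phi(d) (f(d) - f(c))]. *)
Lemma parts_defect_coarse (c d : R) :
  a <= c -> c <= d -> d <= b ->
  Rabs (defect c d) <= (K + B * (d - c)) * (V d - V c).
Proof.
  intros Hc Hcd Hd. unfold defect.
  assert (HI : RInt phi c d = Phi d - Phi c).
  { apply is_RInt_unique, (is_RInt_derive (V := R_CompleteNormedModule)).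
    - intros x. rewrite Rmin_left, Rmax_right by lra. intros Hx. apply HPhi. lra.
    - intros x _. exact (bounded_lipschitz_continuous _ _ _ _ Hphi). }
  assert (Hex : ex_RInt (fun t => f t * phi t) c d).
  { apply ex_RInt_controlled_mult with V B L; [exact Hcd| |exact Hphi].
    apply controlled_sub with a b; assumption. }
  assert (Hexp : ex_RInt (fun t => f c * phi t) c d).
  { apply (ex_RInt_scal (V := R_NormedModule)).
    exact (ex_RInt_bounded_lipschitz _ _ _ _ _ Hphi). }
  assert (Hdiff : RInt (fun t => f t * phi t - f c * phi t) c d
    = RInt (fun t => f t * phi t) c d - f c * (Phi d - Phi c)).
  { rewrite <- HI. rewrite <- (RInt_scal (V := R_CompleteNormedModule) phi).
    - apply (RInt_minus (V := R_CompleteNormedModule)); assumption.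
    - exact (ex_RInt_bounded_lipschitz _ _ _ _ _ Hphi). }
  replace (RInt (fun t => f t * phi t) c d - (f d * Phi d - f c * Phi c))
    with (RInt (fun t => f t * phi t - f c * phi t) c d - Phi d * (f d - f c))
    by (rewrite Hdiff; ring).
  assert (H1 : Rabs (RInt (fun t => f t * phi t - f c * phi t) c d)
               <= (d - c) * ((V d - V c) * B)).
  { apply abs_RInt_le_const; [exact Hcd| |].
    - apply (ex_RInt_minus (V := R_NormedModule)); assumption.
    - intros t Ht.
      replace (f t * phi t - f c * phi t) with ((f t - f c) * phi t) by ring.
      rewrite Rabs_mult. apply Rmult_le_compat; try apply Rabs_pos.
      + assert (H1 := Hf c t); feed H1. assert (H2 := Hf t d); feed H2.
        assert (H3 := Rabs_pos (f d - f t)). lra.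
      + apply Hphi. }
  assert (H2 : Rabs (Phi d * (f d - f c)) <= K * (V d - V c)).
  { rewrite Rabs_mult. apply Rmult_le_compat; try apply Rabs_pos.
    - apply HK; lra.
    - apply Hf; lra. }
  assert (H3 := Rabs_triang (RInt (fun t => f t * phi t - f c * phi t) c d)
                            (- (Phi d * (f d - f c)))).
  rewrite Rabs_Ropp in H3. unfold Rminus at 1. lra.
Qed.

(** The defect is additive in the interval and so is the increment of [V], so
    that a subdivision replaces the length of the interval by the mesh in the
    freezing error. *)
Lemma parts_defect_subdivided (n : nat) (c delta : R) :
  0 <= delta -> a <= c -> c + INR n * delta <= b ->
  Rabs (defect c (c + INR n * delta)) <= (K + B * delta) * (V (c + INR n * delta) - V c).
Proof.
  intros Hdelta Hc. induction n as [|n IH]; intros Hn.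
  - simpl. rewrite Rmult_0_l, Rplus_0_r. unfold defect.
    rewrite RInt_point. unfold zero; simpl. rewrite !Rminus_diag, Rabs_R0. lra.
  - rewrite S_INR in Hn |- *.
    set (d := c + INR n * delta) in *.
    replace (c + (INR n + 1) * delta) with (d + delta) in * by (unfold d; ring).
    assert (Hd : 0 <= INR n * delta) by (apply Rmult_le_pos; [apply pos_INR|assumption]).
    assert (IH' := IH ltac:(lra)).
    assert (Hstep := parts_defect_coarse d (d + delta) ltac:(unfold d; lra) ltac:(lra) Hn).
    replace (d + delta - d) with delta in Hstep by ring.
    replace (defect c (d + delta)) with (defect c d + defect d (d + delta)).
    + eapply Rle_trans; [apply Rabs_triang|]. lra.
    + unfold defect.
      rewrite <- (RInt_Chasles (V := R_CompleteNormedModule) _ c d (d + delta)).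
      * unfold plus; simpl. ring.
      * apply ex_RInt_controlled_mult with V B L; [unfold d; lra| |exact Hphi].
        apply controlled_sub with a b; [assumption|unfold d; lra|lra].
      * apply ex_RInt_controlled_mult with V B L; [lra| |exact Hphi].
        apply controlled_sub with a b; [assumption|unfold d; lra|lra].
Qed.

(** The mesh tends to [0]. The bound no longer depends on [B] and [L], which is
    what allows [phi] to oscillate arbitrarily fast. *)
Lemma integration_by_parts_bound :
  a <= b ->
  Rabs (RInt (fun t => f t * phi t) a b - (f b * Phi b - f a * Phi a))
  <= K * (V b - V a).
Proof.
  intros Hab. apply Rle_plus_epsilon. intros eps Heps.
  assert (HV : 0 <= V b - V a).
  { assert (H := Hf a b); feed H. assert (H' := Rabs_pos (f b - f a)). lra. }
  assert (HB : 0 <= B) by (apply Rle_trans with (1 := Rabs_pos (phi 0)), Hphi).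
  set (X := B * (b - a) * (V b - V a)).
  assert (HX : 0 <= X) by (unfold X; apply Rmult_le_pos; [apply Rmult_le_pos; lra|exact HV]).
  destruct (INR_unbounded (X / eps)) as [n Hn].
  assert (Hn0 : 0 < INR n).
  { apply Rle_lt_trans with (2 := Hn). apply Rdiv_le_0_compat; assumption. }
  assert (H := parts_defect_subdivided n a ((b - a) / INR n)).
  replace (a + INR n * ((b - a) / INR n)) with b in H by (field; lra).
  specialize (H ltac:(apply Rdiv_le_0_compat; lra) ltac:(lra) ltac:(lra)).
  eapply Rle_trans; [exact H|].
  apply Rlt_div_l in Hn; [|exact Heps].
  replace ((K + B * ((b - a) / INR n)) * (V b - V a))
    with (K * (V b - V a) + X / INR n) by (unfold X; field; lra).
  apply Rplus_le_compat_l. apply Rle_div_l; lra.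
Qed.

Lemma oscillatory_integral_bound :
  a <= b ->
  Rabs (RInt (fun t => f t * phi t) a b) <= K * (Rabs (f a) + Rabs (f b) + (V b - V a)).
Proof.
  intros Hab. assert (H := integration_by_parts_bound Hab).
  set (I := RInt (fun t => f t * phi t) a b : R) in *.
  assert (H1 := Rabs_triang (I - (f b * Phi b - f a * Phi a)) (f b * Phi b - f a * Phi a)).
  replace (I - (f b * Phi b - f a * Phi a) + (f b * Phi b - f a * Phi a)) with I in H1 by ring.
  assert (H2 := Rabs_triang (f b * Phi b) (- (f a * Phi a))).
  fold (f b * Phi b - f a * Phi a) in H2.
  rewrite Rabs_Ropp, !Rabs_mult in H2.
  assert (H3 := Rmult_le_compat_l _ _ _ (Rabs_pos (f b)) (HK b ltac:(lra))).
  assert (H4 := Rmult_le_compat_l _ _ _ (Rabs_pos (f a)) (HK a ltac:(lra))).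
  lra.
Qed.

End SummationByParts.

(** * Differentiation under the integral sign *)

Lemma cos_lipschitz (x y : R) : Rabs (cos y - cos x) <= Rabs (y - x).
Proof.
  destruct (MVT_gen cos x y (fun t => - sin t)) as [c [_ ->]].
  - intros t _. auto_derive; [exact I|ring].
  - intros t _. apply continuity_cos.
  - rewrite Rabs_mult, Rabs_Ropp. rewrite <- (Rmult_1_l (Rabs (y - x))) at 2.
    apply Rmult_le_compat_r; [apply Rabs_pos|]. apply Rabs_le, SIN_bound.
Qed.

Lemma Rabs_cos_le_1 (x : R) : Rabs (cos x) <= 1.
Proof. apply Rabs_le, COS_bound. Qed.

Lemma Rabs_sin_le_1 (x : R) : Rabs (sin x) <= 1.
Proof. apply Rabs_le, SIN_bound. Qed.

Lemma cos_bounded_lipschitz (s c : R) :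
  bounded_lipschitz (fun t => cos (s * t + c)) 1 (Rabs s).
Proof.
  split.
  - intros t. apply Rabs_cos_le_1.
  - intros x y. eapply Rle_trans; [apply cos_lipschitz|].
    rewrite <- Rabs_mult. apply Req_le. f_equal. ring.
Qed.

Lemma bounded_lipschitz_ext (phi psi : R -> R) (B L : R) :
  (forall t, phi t = psi t) -> bounded_lipschitz phi B L -> bounded_lipschitz psi B L.
Proof.
  intros He [H1 H2]. split.
  - intros t. rewrite <- He. apply H1.
  - intros x y. rewrite <- !He. apply H2.
Qed.

Lemma is_derive_quadratic_error (F : R -> R) (x l C : R) :
  (forall y, Rabs (F y - F x - (y - x) * l) <= C * (y - x)²) -> is_derive F x l.
Proof.
  intros HF. apply is_derive_Reals. intros eps Heps.
  assert (HC : 0 <= C).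
  { assert (H := HF (x + 1)). replace (x + 1 - x) with 1 in H by ring.
    rewrite Rsqr_1 in H. assert (H' := Rabs_pos (F (x + 1) - F x - 1 * l)). lra. }
  assert (Hd : 0 < eps / (C + 1)) by (apply Rdiv_lt_0_compat; lra).
  exists (mkposreal _ Hd). intros h Hh Hlt. simpl in Hlt.
  assert (H := HF (x + h)). replace (x + h - x) with h in H by ring.
  replace ((F (x + h) - F x) / h - l) with ((F (x + h) - F x - h * l) / h) by (field; exact Hh).
  assert (Hp := Rabs_pos_lt h Hh).
  unfold Rdiv. rewrite Rabs_mult, Rabs_inv.
  apply Rlt_div_l; [exact Hp|].
  eapply Rle_lt_trans; [exact H|]. apply Rlt_div_r in Hlt; [|lra].
  rewrite Rsqr_abs. unfold Rsqr.
  assert (C * Rabs h < eps) by nra. nra.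
Qed.

Lemma taylor_lipschitz_derivative (F dF : R -> R) (L x y : R) :
  (forall s, is_derive F s (dF s)) ->
  (forall s, Rabs (dF s - dF x) <= L * Rabs (s - x)) ->
  Rabs (F y - F x - (y - x) * dF x) <= L * (y - x)².
Proof.
  intros HF HL.
  destruct (MVT_gen F x y dF) as [c [Hc ->]].
  - intros s _. apply HF.
  - intros s _. apply continuity_pt_filterlim, (ex_derive_continuous F).
    exists (dF s). apply HF.
  - replace (dF c * (y - x) - (y - x) * dF x) with ((dF c - dF x) * (y - x)) by ring.
    rewrite Rabs_mult, Rsqr_abs. unfold Rsqr. rewrite <- Rmult_assoc.
    apply Rmult_le_compat_r; [apply Rabs_pos|].
    eapply Rle_trans; [apply HL|].
    assert (HL0 : 0 <= L).
    { assert (H := HL (x + 1)). replace (x + 1 - x) with 1 in H by ring.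
      rewrite Rabs_R1 in H. assert (H' := Rabs_pos (dF (x + 1) - dF x)). lra. }
    apply Rmult_le_compat_l; [exact HL0|].
    revert Hc. unfold Rmin, Rmax. destruct (Rle_dec x y); intros Hc.
    + rewrite !Rabs_pos_eq; lra.
    + rewrite !Rabs_left1; lra.
Qed.

(** The weight [h] may be discontinuous: the Taylor error of [phi] in the
    parameter is quadratic uniformly in [t], and integrating it against a bounded
    weight keeps it quadratic. *)
Lemma is_derive_RInt_weighted (h : R -> R) (phi psi : R -> R -> R) (a b M L : R) (s : R) :
  a <= b ->
  (forall t, a <= t <= b -> Rabs (h t) <= M) ->
  (forall r t, is_derive (fun r => phi r t) r (psi r t)) ->
  (forall r r' t, a <= t <= b -> Rabs (psi r' t - psi r t) <= L * Rabs (r' - r)) ->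
  (forall r, ex_RInt (fun t => h t * phi r t) a b) ->
  (forall r, ex_RInt (fun t => h t * psi r t) a b) ->
  is_derive (fun r => RInt (fun t => h t * phi r t) a b) s
            (RInt (fun t => h t * psi s t) a b).
Proof.
  intros Hab HM Hd HL Hphi Hpsi.
  apply is_derive_quadratic_error with ((b - a) * (M * L)). intros y.
  assert (Hsc : ex_RInt (fun t => (y - s) * (h t * psi s t)) a b)
    by (apply (ex_RInt_scal (V := R_NormedModule)), Hpsi).
  replace (RInt (fun t => h t * phi y t) a b - RInt (fun t => h t * phi s t) a b
           - (y - s) * RInt (fun t => h t * psi s t) a b)
    with (RInt (fun t => h t * phi y t - h t * phi s t - (y - s) * (h t * psi s t)) a b).
  - replace ((b - a) * (M * L) * (y - s)²) with ((b - a) * (M * (L * (y - s)²))) by ring.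
    apply abs_RInt_le_const; [exact Hab| |].
    + apply (ex_RInt_minus (V := R_NormedModule)); [|exact Hsc].
      apply (ex_RInt_minus (V := R_NormedModule)); apply Hphi.
    + intros t Ht.
      replace (h t * phi y t - h t * phi s t - (y - s) * (h t * psi s t))
        with (h t * (phi y t - phi s t - (y - s) * psi s t)) by ring.
      rewrite Rabs_mult. apply Rmult_le_compat; try apply Rabs_pos.
      * apply HM, Ht.
      * apply (taylor_lipschitz_derivative (fun r => phi r t) (fun r => psi r t)).
        -- intros r. apply Hd.
        -- intros r. apply HL, Ht.
  - rewrite <- (RInt_scal (V := R_CompleteNormedModule)) by apply Hpsi.
    rewrite <- (RInt_minus (V := R_CompleteNormedModule)) by apply Hphi.
    apply (RInt_minus (V := R_CompleteNormedModule)); [|exact Hsc].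
    apply (ex_RInt_minus (V := R_NormedModule)); apply Hphi.
Qed.

(** * The sine integral *)

(** This is [sin v / v], in a form that is regular at [0]. *)
Definition sinc (v : R) : R := RInt (fun s => cos (v * s)) 0 1.

Lemma ex_RInt_cos_mult (v a b : R) : ex_RInt (fun s => cos (v * s)) a b.
Proof.
  apply (ex_RInt_bounded_lipschitz _ 1 (Rabs v)).
  apply (bounded_lipschitz_ext (fun t => cos (v * t + 0))).
  - intros t. f_equal. ring.
  - apply cos_bounded_lipschitz.
Qed.

Lemma mult_sinc (v : R) : v * sinc v = sin v.
Proof.
  unfold sinc.
  rewrite <- (RInt_scal (V := R_CompleteNormedModule)) by apply ex_RInt_cos_mult.
  apply is_RInt_unique.
  replace (sin v) with (minus (sin (v * 1)) (sin (v * 0)))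
    by (rewrite Rmult_0_r, sin_0, Rmult_1_r; unfold minus, plus, opp; simpl; ring).
  apply (is_RInt_derive (V := R_CompleteNormedModule) (fun s => sin (v * s))).
  - intros x _. auto_derive; [exact I|]. unfold scal; simpl; unfold mult; simpl. ring.
  - intros x _. apply (ex_derive_continuous (fun s => v * cos (v * s))).
    auto_derive. exact I.
Qed.

Lemma sinc_0 : sinc 0 = 1.
Proof.
  unfold sinc. rewrite (RInt_ext _ (fun _ => 1)).
  - rewrite RInt_const. unfold scal; simpl; unfold mult; simpl. ring.
  - intros x _. rewrite Rmult_0_l. apply cos_0.
Qed.

Lemma sinc_bounded_lipschitz : bounded_lipschitz sinc 1 1.
Proof.
  split.
  - intros t. unfold sinc. replace 1 with ((1 - 0) * 1) at 2 by ring.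
    apply abs_RInt_le_const; [lra|apply ex_RInt_cos_mult|].
    intros s _. apply Rabs_cos_le_1.
  - intros x y. unfold sinc.
    rewrite <- (RInt_minus (V := R_CompleteNormedModule)) by apply ex_RInt_cos_mult.
    replace (1 * Rabs (y - x)) with ((1 - 0) * Rabs (y - x)) by ring.
    apply abs_RInt_le_const; [lra| |].
    + apply (ex_RInt_minus (V := R_NormedModule)); apply ex_RInt_cos_mult.
    + intros s Hs. eapply Rle_trans; [apply cos_lipschitz|].
      replace (y * s - x * s) with ((y - x) * s) by ring.
      rewrite Rabs_mult, (Rabs_pos_eq s) by lra.
      assert (H := Rabs_pos (y - x)). nra.
Qed.

(** The real part of [exp (- x e^(-i th))]. *)
Definition arc_kernel (x th : R) : R := exp (- (x * cos th)) * cos (x * sin th).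

Definition arc_integral (x : R) : R := RInt (arc_kernel x) 0 (PI / 2).

Lemma ex_RInt_arc_kernel (x a b : R) : ex_RInt (arc_kernel x) a b.
Proof.
  apply (ex_RInt_continuous (V := R_CompleteNormedModule)). intros z _.
  apply (ex_derive_continuous (arc_kernel x)). unfold arc_kernel.
  auto_derive. exact I.
Qed.

Definition arc_kernel_derivative (x th : R) : R :=
  - (exp (- (x * cos th)) * (cos th * cos (x * sin th) + sin th * sin (x * sin th))).

Lemma is_derive_arc_kernel (x th : R) :
  is_derive (fun x => arc_kernel x th) x (arc_kernel_derivative x th).
Proof.
  unfold arc_kernel, arc_kernel_derivative. auto_derive; [exact I|]. ring.
Qed.

(** Differentiating [exp (- x e^(-i th))] in [x] or in [th] gives the same
    function up to the factor [i x], so that [x] times the derivative of the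
    integral is an explicit boundary term, equal to [- sin x]. *)
Lemma is_derive_arc_integral (x : R) : is_derive arc_integral x (- sinc x).
Proof.
  assert (Hint : RInt (arc_kernel_derivative x) 0 (PI / 2) = - sinc x).
  { destruct (Req_dec x 0) as [->|Hx].
    - rewrite sinc_0.
      replace (- (1)) with (minus (- sin (PI / 2)) (- sin 0))
        by (rewrite sin_PI2, sin_0; unfold minus, plus, opp; simpl; ring).
      apply is_RInt_unique, (is_RInt_derive (V := R_CompleteNormedModule) (fun t => - sin t)).
      + intros t _. unfold arc_kernel_derivative.
        rewrite !Rmult_0_l, sin_0, cos_0, Ropp_0, exp_0.
        auto_derive; [exact I|ring].
      + intros t _. apply (ex_derive_continuous (arc_kernel_derivative 0)).
        unfold arc_kernel_derivative. auto_derive. exact I.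
    - replace (- sinc x) with (- (sin x / x)) by (rewrite <- (mult_sinc x); field; exact Hx).
      set (P := fun t => - (exp (- (x * cos t)) * sin (x * sin t)) / x).
      replace (- (sin x / x)) with (minus (P (PI / 2)) (P 0)).
      2: { unfold P, minus, plus, opp; simpl.
           rewrite cos_PI2, sin_PI2, sin_0, Rmult_0_r, Ropp_0, exp_0, sin_0, Rmult_1_r.
           field. exact Hx. }
      apply is_RInt_unique, (is_RInt_derive (V := R_CompleteNormedModule) P).
      + intros t _. unfold P, arc_kernel_derivative.
        auto_derive; [exact I|]. field. exact Hx.
      + intros t _. apply (ex_derive_continuous (arc_kernel_derivative x)).
        unfold arc_kernel_derivative. auto_derive. exact I. }
  rewrite <- Hint.
  replace (RInt (arc_kernel_derivative x) 0 (PI / 2))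
    with (RInt (fun t => Derive (fun u => arc_kernel u t) x) 0 (PI / 2)).
  2: { apply RInt_ext. intros t _. apply is_derive_unique, is_derive_arc_kernel. }
  apply is_derive_RInt_param.
  - apply filter_forall. intros y t _. eexists. apply is_derive_arc_kernel.
  - intros t _. apply continuity_2d_pt_ext with arc_kernel_derivative.
    + intros u v. symmetry. apply is_derive_unique, is_derive_arc_kernel.
    + assert (Hid2 : forall g : R -> R, continuity g ->
        continuity_2d_pt (fun _ v => g v) x t).
      { intros g Hg. apply (continuity_1d_2d_pt_comp g (fun _ v => v)).
        - apply Hg.
        - apply continuity_2d_pt_id2. }
      assert (Hprod : forall g : R -> R, continuity g ->
        continuity_2d_pt (fun u v => u * g v) x t).
      { intros g Hg. apply continuity_2d_pt_mult; [apply continuity_2d_pt_id1|].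
        apply Hid2, Hg. }
      unfold arc_kernel_derivative.
      apply continuity_2d_pt_opp, continuity_2d_pt_mult.
      * apply (continuity_1d_2d_pt_comp exp (fun u v => - (u * cos v))).
        -- apply derivable_continuous_pt, derivable_pt_exp.
        -- apply continuity_2d_pt_opp, Hprod, continuity_cos.
      * apply continuity_2d_pt_plus; apply continuity_2d_pt_mult.
        -- apply Hid2, continuity_cos.
        -- apply (continuity_1d_2d_pt_comp cos (fun u v => u * sin v)).
           ++ apply continuity_cos.
           ++ apply Hprod, continuity_sin.
        -- apply Hid2, continuity_sin.
        -- apply (continuity_1d_2d_pt_comp sin (fun u v => u * sin v)).
           ++ apply continuity_sin.
           ++ apply Hprod, continuity_sin.
  - apply filter_forall. intros y. apply ex_RInt_arc_kernel.
Qed.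

(** The primitive of [sinc] that vanishes at [0]. Written in this way, its limit
    at infinity is visible: the arc integral decays. *)
Definition sine_integral (v : R) : R := PI / 2 - arc_integral v.

Lemma is_derive_sine_integral (v : R) : is_derive sine_integral v (sinc v).
Proof.
  replace (sinc v) with (0 - - sinc v) by ring.
  apply (is_derive_minus (V := R_NormedModule) (fun _ => PI / 2) arc_integral).
  - apply (is_derive_const (V := R_NormedModule)).
  - apply is_derive_arc_integral.
Qed.

Lemma sine_integral_0 : sine_integral 0 = 0.
Proof.
  unfold sine_integral, arc_integral.
  rewrite (RInt_ext _ (fun _ => 1)).
  - rewrite RInt_const. change (PI / 2 - (PI / 2 - 0) * 1 = 0). ring.
  - intros x _. unfold arc_kernel.
    rewrite !Rmult_0_l, Ropp_0, exp_0, cos_0. apply Rmult_1_r.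
Qed.

(** The integrand is at most [exp (- v sin e)] except on an interval of length
    [e] next to [PI / 2], where it is at most [1]. *)
Lemma arc_integral_bound (v e : R) :
  0 <= v -> 0 <= e <= PI / 2 ->
  Rabs (arc_integral v) <= PI / 2 * exp (- (v * sin e)) + e.
Proof.
  intros Hv He. unfold arc_integral.
  assert (HPI := PI_RGT_0).
  rewrite <- (RInt_Chasles (V := R_CompleteNormedModule) _ 0 (PI / 2 - e))
    by apply ex_RInt_arc_kernel.
  unfold plus; simpl. eapply Rle_trans; [apply Rabs_triang|].
  assert (Hk : forall t c, c <= cos t -> Rabs (arc_kernel v t) <= exp (- (v * c))).
  { intros t c Hc. unfold arc_kernel. rewrite Rabs_mult.
    rewrite (Rabs_pos_eq (exp _)) by (left; apply exp_pos).
    rewrite <- (Rmult_1_r (exp (- (v * c)))).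
    apply Rmult_le_compat; [left; apply exp_pos|apply Rabs_pos| |apply Rabs_cos_le_1].
    assert (Hle : - (v * cos t) <= - (v * c)) by nra.
    destruct Hle as [Hlt| ->]; [left; apply exp_increasing, Hlt|apply Rle_refl]. }
  apply Rplus_le_compat.
  - apply Rle_trans with ((PI / 2 - e - 0) * exp (- (v * sin e))).
    + apply abs_RInt_le_const; [lra|apply ex_RInt_arc_kernel|].
      intros t Ht. apply Hk. rewrite <- cos_shift. apply cos_decr_1; lra.
    + apply Rmult_le_compat_r; [left; apply exp_pos|lra].
  - replace e with ((PI / 2 - (PI / 2 - e)) * 1) at 2 by ring.
    apply abs_RInt_le_const; [lra|apply ex_RInt_arc_kernel|].
    intros t Ht. rewrite <- exp_0. replace 0 with (- (v * 0)) by ring.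
    apply Hk. apply cos_ge_0; lra.
Qed.

Lemma sine_integral_bound (v : R) : 0 <= v -> Rabs (sine_integral v) <= PI.
Proof.
  intros Hv. assert (HPI := PI_RGT_0).
  assert (H := arc_integral_bound v 0 Hv ltac:(lra)).
  rewrite sin_0, Rmult_0_r, Ropp_0, exp_0 in H.
  apply Rabs_le_between in H.
  unfold sine_integral. apply Rabs_le. lra.
Qed.

Lemma sine_integral_limit (eps : R) :
  0 < eps ->
  exists A, 0 < A /\ forall v, A <= v -> Rabs (sine_integral v - PI / 2) <= eps.
Proof.
  intros Heps. assert (HPI := PI_RGT_0). assert (HPI4 := PI_4).
  set (e := Rmin (eps / 2) (PI / 4)).
  assert (He : 0 < e <= PI / 4 /\ e <= eps / 2).
  { unfold e. split; [split|]; [apply Rmin_glb_lt; lra|apply Rmin_r|apply Rmin_l]. }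
  assert (Hs : 0 < sin e) by (apply sin_gt_0; lra).
  set (c := sin e) in *.
  exists (2 * PI / (eps * c)). split.
  - apply Rdiv_lt_0_compat; nra.
  - intros v Hv. apply Rle_div_l in Hv; [|nra].
    assert (Hes : 0 < eps * c) by (apply Rmult_lt_0_compat; assumption).
    assert (Hv0 : 0 < v) by nra.
    unfold sine_integral.
    replace (PI / 2 - arc_integral v - PI / 2) with (- arc_integral v) by ring.
    rewrite Rabs_Ropp.
    eapply Rle_trans; [apply (arc_integral_bound v e); lra|]; fold c.
    assert (Hexp : exp (- (v * c)) * (v * c) <= 1).
    { assert (H := exp_ineq1_le (v * c)). assert (H' := exp_pos (- (v * c))).
      assert (H'' : exp (- (v * c)) * exp (v * c) = 1)
        by (rewrite <- exp_plus, Rplus_opp_l; apply exp_0). nra. }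
    assert (H' := exp_pos (- (v * c))).
    assert (PI / 2 * exp (- (v * c)) <= eps / 2); [|lra].
    assert (H1 := Rmult_le_compat_l _ _ _ (Rlt_le _ _ H') Hv).
    assert (H2 := Rmult_le_compat_l _ _ _ (Rlt_le _ _ Heps) Hexp).
    replace (exp (- (v * c)) * (v * (eps * c)))
      with (eps * (exp (- (v * c)) * (v * c))) in H1 by ring.
    assert (0 <= PI * exp (- (v * c))) by nra. lra.
Qed.

(** * The Fourier cosine and sine integrals on a half-line *)

Lemma bounded_monotone_tail (W : R -> R) (M eps : R) :
  (forall x y, 0 <= x -> x <= y -> W x <= W y) ->
  (forall x, 0 <= x -> W x <= M) -> 0 < eps ->
  exists A, 0 < A /\ forall u v, A <= u -> u <= v -> W v - W u <= eps.
Proof.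
  intros Hm HM Heps.
  destruct (completeness (fun w => exists x, 0 <= x /\ w = W x)) as [s [Hs1 Hs2]].
  - exists M. intros w (x & Hx & ->). apply HM, Hx.
  - exists (W 0), 0. split; [lra|reflexivity].
  - destruct (classic (exists x, 0 <= x /\ s - eps < W x)) as [(x & Hx & Hw)|Hn].
    + exists (x + 1). split; [lra|]. intros u v Hu Huv.
      assert (H1 := Hm x u Hx ltac:(lra)).
      assert (H2 : W v <= s) by (apply Hs1; exists v; split; [lra|reflexivity]). lra.
    + exfalso. assert (s <= s - eps); [|lra].
      apply Hs2. intros w (x & Hx & ->). apply Rnot_lt_le. intros Hlt.
      apply Hn. exists x. split; assumption.
Qed.

Lemma bounded_monotone_right (W : R -> R) (x M eps : R) :
  (forall u v, x < u -> u <= v -> W u <= W v) ->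
  (forall u, x < u -> M <= W u) -> 0 < eps ->
  exists d, 0 < d /\ forall u v, x < u -> u <= v -> v <= x + d -> W v - W u <= eps.
Proof.
  intros Hm HM Heps.
  destruct (completeness (fun w => exists u, x < u /\ w = - W u)) as [s [Hs1 Hs2]].
  - exists (- M). intros w (u & Hu & ->). assert (H := HM u Hu). lra.
  - exists (- W (x + 1)), (x + 1). split; [lra|reflexivity].
  - destruct (classic (exists u, x < u /\ s - eps < - W u)) as [(y & Hy & Hw)|Hn].
    + exists (y - x). split; [lra|]. intros u v Hu Huv Hv.
      assert (H1 := Hm v y ltac:(lra) ltac:(lra)).
      assert (H2 : - W u <= s) by (apply Hs1; exists u; split; [lra|reflexivity]). lra.
    + exfalso. assert (s <= s - eps); [|lra].
      apply Hs2. intros w (u & Hu & ->). apply Rnot_lt_le. intros Hlt.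
      apply Hn. exists u. split; assumption.
Qed.

Lemma sinc_kernel_bounded_lipschitz (T : R) :
  bounded_lipschitz (fun u => T * sinc (T * u)) (Rabs T) (Rabs T * Rabs T).
Proof.
  destruct sinc_bounded_lipschitz as [H1 H2]. assert (HT := Rabs_pos T). split.
  - intros t. rewrite Rabs_mult.
    assert (H := H1 (T * t)). nra.
  - intros x y. rewrite <- Rmult_minus_distr_l, Rabs_mult, Rmult_assoc.
    apply Rmult_le_compat_l; [exact HT|].
    eapply Rle_trans; [apply H2|].
    rewrite <- Rmult_minus_distr_l, Rabs_mult. lra.
Qed.

Lemma is_derive_sine_integral_scaled (T k u : R) :
  is_derive (fun u => sine_integral (T * u) - k) u (T * sinc (T * u)).
Proof.
  replace (T * sinc (T * u)) with (T * sinc (T * u) - 0) by ring.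
  apply (is_derive_minus (V := R_NormedModule) (fun u => sine_integral (T * u)) (fun _ => k)).
  - apply (is_derive_comp sine_integral (fun u => T * u)).
    + apply is_derive_sine_integral.
    + auto_derive; [exact I|apply Rmult_1_r].
  - apply (is_derive_const (V := R_NormedModule)).
Qed.

Lemma is_derive_mult_sinc (u T : R) :
  is_derive (fun T => T * sinc (T * u)) T (cos (T * u)).
Proof.
  destruct (Req_dec u 0) as [->|Hu].
  - apply is_derive_ext with (fun T => T).
    + intros t. rewrite Rmult_0_r, sinc_0. symmetry; apply Rmult_1_r.
    + rewrite Rmult_0_r, cos_0. apply (is_derive_id (K := R_AbsRing)).
  - apply is_derive_ext with (fun T => sin (T * u) / u).
    + intros t. rewrite <- mult_sinc. change (t * u * sinc (t * u) / u = t * sinc (t * u)). field. exact Hu.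
    + auto_derive; [exact I|]. field. exact Hu.
Qed.

(** [h] is one half of [f], seen from the point [x]; [W] controls it. *)
Section HalfLine.

Variables (h W : R -> R) (M : R).
Hypothesis Hh : forall x y, 0 <= x -> x <= y -> Rabs (h y - h x) <= W y - W x.
Hypothesis HW : forall x, 0 <= x -> Rabs (W x) <= M.
Hypothesis Hinf : is_lim h p_infty 0.

Lemma half_line_controlled (a b : R) : 0 <= a -> controlled h W a b.
Proof. intros Ha x y Hx Hxy _. apply Hh; lra. Qed.

Lemma half_line_monotone (x y : R) : 0 <= x -> x <= y -> W x <= W y.
Proof. intros Hx Hxy. assert (H := Hh x y Hx Hxy). assert (H' := Rabs_pos (h y - h x)). lra. Qed.

Lemma half_line_variation (x y : R) : 0 <= x -> x <= y -> W y - W x <= 2 * M.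
Proof.
  intros Hx Hxy. assert (H1 := HW x Hx). assert (H2 := HW y ltac:(lra)).
  apply Rabs_le_between in H1. apply Rabs_le_between in H2. lra.
Qed.

Let bound : R := Rabs (h 0) + 2 * M.

Lemma half_line_bounded (x : R) : 0 <= x -> Rabs (h x) <= bound.
Proof.
  intros Hx. assert (H := controlled_bounded h W 0 x x (half_line_controlled 0 x (Rle_refl 0)) ltac:(lra)).
  assert (H' := half_line_variation 0 x ltac:(lra) Hx). unfold bound. lra.
Qed.

Lemma half_line_tail (eps : R) :
  0 < eps -> exists A, 0 < A /\ forall u v, A <= u -> u <= v ->
    Rabs (h u) + Rabs (h v) + (W v - W u) <= eps.
Proof.
  intros Heps.
  destruct (bounded_monotone_tail W M (eps / 3)) as (A1 & HA1 & H1).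
  - apply half_line_monotone.
  - intros x Hx. eapply Rle_trans; [apply Rle_abs|]. apply HW, Hx.
  - lra.
  - apply is_lim_spec in Hinf.
    assert (He : 0 < eps / 3) by lra.
    destruct (Hinf (mkposreal _ He)) as [A2 H2]. simpl in H2.
    exists (Rmax A1 (A2 + 1)).
    assert (HR := Rmax_l A1 (A2 + 1)). assert (HR' := Rmax_r A1 (A2 + 1)).
    split; [lra|].
    intros u v Hu Huv.
    assert (H3 := H1 u v ltac:(lra) Huv).
    assert (H4 := H2 u ltac:(lra)). assert (H5 := H2 v ltac:(lra)).
    rewrite Rminus_0_r in H4, H5. lra.
Qed.

Lemma ex_RInt_half_cos (s c a b : R) :
  0 <= a -> a <= b -> ex_RInt (fun u => h u * cos (s * u + c)) a b.
Proof.
  intros Ha Hab. apply ex_RInt_controlled_mult with W 1 (Rabs s).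
  - exact Hab.
  - apply half_line_controlled, Ha.
  - apply cos_bounded_lipschitz.
Qed.

(** The primitive [sin(st + c)/s] is at most [1/S]: the bound is uniform in the
    frequency [s] and in the phase [c]. *)
Lemma oscillatory_tail (S eps : R) :
  0 < S -> 0 < eps -> exists A, 0 < A /\ forall s c u v,
    S <= Rabs s -> A <= u -> u <= v ->
    Rabs (RInt (fun t => h t * cos (s * t + c)) u v) <= eps.
Proof.
  intros HS Heps.
  destruct (half_line_tail (eps * S)) as (A & HA & H); [nra|].
  exists A. split; [exact HA|]. intros s c u v Hs Hu Huv.
  assert (Hs0 : s <> 0) by (intros ->; rewrite Rabs_R0 in Hs; lra).
  eapply Rle_trans.
  - apply (oscillatory_integral_bound h W (fun t => cos (s * t + c))
             (fun t => sin (s * t + c) / s) u v 1 (Rabs s) (/ S)).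
    + apply half_line_controlled. lra.
    + apply cos_bounded_lipschitz.
    + intros t _. auto_derive; [exact I|]. field. exact Hs0.
    + intros t _. unfold Rdiv. rewrite Rabs_mult, Rabs_inv.
      rewrite <- (Rmult_1_l (/ S)). apply Rmult_le_compat.
      * apply Rabs_pos.
      * left. apply Rinv_0_lt_compat. lra.
      * apply Rabs_sin_le_1.
      * apply Rinv_le_contravar; assumption.
    + exact Huv.
  - assert (H' := H u v Hu Huv). apply Rmult_le_reg_l with S; [exact HS|].
    rewrite <- Rmult_assoc, Rinv_r by lra. lra.
Qed.

(** The phase [c] serves both integrals: [c = 0] is the cosine and
    [c = - PI/2] the sine. *)
Definition truncated_transform (c b s : R) : R :=
  RInt (fun u => h u * cos (s * u + c)) 0 b.

Lemma truncated_transform_tail (S eps : R) :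
  0 < S -> 0 < eps -> exists A, 0 < A /\ forall s c u v,
    S <= Rabs s -> A <= u -> A <= v ->
    Rabs (truncated_transform c u s - truncated_transform c v s) <= eps.
Proof.
  intros HS Heps.
  destruct (oscillatory_tail S eps HS Heps) as (A & HA & H).
  exists A. split; [exact HA|].
  assert (Hle : forall s c u v, S <= Rabs s -> A <= u -> u <= v ->
    Rabs (truncated_transform c u s - truncated_transform c v s) <= eps).
  { intros s c u v Hs Hu Huv. rewrite Rabs_minus_sym. unfold truncated_transform.
    rewrite <- (RInt_Chasles (V := R_CompleteNormedModule) _ 0 u v)
      by (apply ex_RInt_half_cos; lra).
    unfold plus; simpl.
    rewrite Rplus_minus_l.
    apply H; assumption. }
  intros s c u v Hs Hu Hv. destruct (Rle_dec u v).
  - apply Hle; assumption.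
  - rewrite Rabs_minus_sym. apply Hle; lra.
Qed.

Lemma ex_half_line_transform (c s : R) :
  s <> 0 -> exists l : R,
    filterlim (fun b => truncated_transform c b s) (Rbar_locally p_infty) (locally l).
Proof.
  intros Hs. apply (filterlim_locally_cauchy (U := R_CompleteSpace)). intros eps.
  destruct (truncated_transform_tail (Rabs s) (eps / 2)) as (A & _ & H).
  - apply Rabs_pos_lt, Hs.
  - apply is_pos_div_2.
  - exists (fun b => A < b). split.
    + exists A. trivial.
    + intros u v Hu Hv. change (Rabs (truncated_transform c v s - truncated_transform c u s) < eps).
      eapply Rle_lt_trans; [apply H; lra|]. assert (H' := cond_pos eps). lra.
Qed.

Definition half_line_transform (c s : R) : R :=
  real (Lim (fun b => truncated_transform c b s) p_infty).

Lemma half_line_transform_correct (c s : R) :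
  s <> 0 -> filterlim (fun b => truncated_transform c b s) (Rbar_locally p_infty)
              (locally (half_line_transform c s)).
Proof.
  intros Hs. destruct (ex_half_line_transform c s Hs) as [l Hl].
  unfold half_line_transform.
  rewrite (is_lim_unique (fun b => truncated_transform c b s) p_infty l Hl). exact Hl.
Qed.

Lemma half_line_transform_uniform (S eps : R) :
  0 < S -> 0 < eps -> exists A, 0 < A /\ forall s c u,
    S <= Rabs s -> A <= u ->
    Rabs (truncated_transform c u s - half_line_transform c s) <= eps.
Proof.
  intros HS Heps. destruct (truncated_transform_tail S eps HS Heps) as (A & HA & H).
  exists A. split; [exact HA|]. intros s c u Hs Hu.
  apply Rle_plus_epsilon. intros e He.
  assert (Hs0 : s <> 0) by (intros ->; rewrite Rabs_R0 in Hs; lra).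
  assert (Hl := half_line_transform_correct c s Hs0).
  apply (proj1 (filterlim_locally _ _)) with (eps := mkposreal e He) in Hl.
  destruct Hl as [N HN].
  assert (H1 := HN (Rmax A (N + 1)) ltac:(assert (H' := Rmax_r A (N + 1)); lra)).
  change (Rabs (truncated_transform c (Rmax A (N + 1)) s - half_line_transform c s) < e) in H1.
  assert (H2 := H s c u (Rmax A (N + 1)) Hs Hu (Rmax_l _ _)).
  assert (H3 := Rabs_triang (truncated_transform c u s - truncated_transform c (Rmax A (N + 1)) s)
    (truncated_transform c (Rmax A (N + 1)) s - half_line_transform c s)).
  match type of H3 with Rabs ?x <= _ =>
    replace x with (truncated_transform c u s - half_line_transform c s) in H3 by ring end.
  lra.
Qed.

Lemma truncated_transform_lipschitz (c b : R) :
  0 <= b -> exists K L, bounded_lipschitz (truncated_transform c b) K L.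
Proof.
  intros Hb. exists (b * bound), (b * (bound * b)).
  assert (HB := fun t (Ht : 0 <= t <= b) => half_line_bounded t (proj1 Ht)).
  split.
  - intros s. unfold truncated_transform.
    replace (b * bound) with ((b - 0) * bound) by ring.
    apply abs_RInt_le_const; [exact Hb|apply ex_RInt_half_cos; lra|].
    intros t Ht. rewrite Rabs_mult, <- (Rmult_1_r bound).
    apply Rmult_le_compat; [apply Rabs_pos|apply Rabs_pos|apply HB, Ht|apply Rabs_cos_le_1].
  - intros x y. unfold truncated_transform.
    rewrite <- (RInt_minus (V := R_CompleteNormedModule)) by (apply ex_RInt_half_cos; lra).
    replace (b * (bound * b) * Rabs (y - x)) with ((b - 0) * (bound * (b * Rabs (y - x)))) by ring.
    apply abs_RInt_le_const; [exact Hb| |].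
    + apply (ex_RInt_minus (V := R_NormedModule)); apply ex_RInt_half_cos; lra.
    + intros t Ht.
      change (Rabs (h t * cos (y * t + c) - h t * cos (x * t + c))
              <= bound * (b * Rabs (y - x))).
      rewrite <- Rmult_minus_distr_l.
      rewrite Rabs_mult.
      apply Rmult_le_compat; [apply Rabs_pos|apply Rabs_pos|apply HB, Ht|].
      eapply Rle_trans; [apply cos_lipschitz|].
      replace (y * t + c - (x * t + c)) with (t * (y - x)) by ring.
      rewrite Rabs_mult, (Rabs_pos_eq t) by lra.
      apply Rmult_le_compat_r; [apply Rabs_pos|lra].
Qed.

(** The convergence as [b] tends to infinity is uniform away from the frequency
    [0], so it can be integrated over [[S, T]]. *)
Lemma half_line_transform_RInt (c S T : R) :
  0 < S -> S <= T ->
  ex_RInt (half_line_transform c) S T /\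
  is_lim_seq (fun n => RInt (truncated_transform c (INR n)) S T)
             (RInt (half_line_transform c) S T).
Proof.
  intros HS HST.
  (* Clamping the frequency at [S] makes the convergence uniform on the whole
     line. *)
  assert (Hclamp : forall (g : R -> R) x, Rmin S T < x < Rmax S T -> g (Rmax S x) = g x).
  { intros g x. rewrite (Rmin_left S T) by lra. intros Hx. rewrite Rmax_right by lra. reflexivity. }
  destruct (filterlim_RInt (V := R_CompleteNormedModule)
    (fun n s => truncated_transform c (INR n) (Rmax S s)) S T eventually _
    (fun s => half_line_transform c (Rmax S s))
    (fun n => RInt (truncated_transform c (INR n)) S T)) as (I & HI1 & HI2).
  - intros n.
    apply (is_RInt_ext (truncated_transform c (INR n))).
    + intros x Hx. symmetry. apply Hclamp, Hx.
    + apply (RInt_correct (V := R_CompleteNormedModule)).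
      destruct (truncated_transform_lipschitz c (INR n) (pos_INR n)) as (K & L & H).
      exact (ex_RInt_bounded_lipschitz _ _ _ _ _ H).
  - apply filterlim_locally. intros eps.
    destruct (half_line_transform_uniform S (eps / 2) HS (is_pos_div_2 eps)) as (A & _ & H).
    destruct (INR_unbounded A) as [N HN]. exists N. intros n Hn s.
    change (Rabs (truncated_transform c (INR n) (Rmax S s) - half_line_transform c (Rmax S s)) < eps).
    apply le_INR in Hn. assert (Hm := Rmax_l S s).
    eapply Rle_lt_trans; [apply H|].
    + rewrite Rabs_pos_eq; lra.
    + lra.
    + assert (H' := cond_pos eps). lra.
  - assert (HI : is_RInt (half_line_transform c) S T I).
    { apply is_RInt_ext with (fun s => half_line_transform c (Rmax S s)); [|exact HI2].
      intros x Hx. apply Hclamp, Hx. }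
    split; [exists I; exact HI|].
    rewrite (is_RInt_unique (V := R_CompleteNormedModule) _ _ _ _ HI). exact HI1.
Qed.

Lemma half_line_transform_even (s : R) :
  half_line_transform 0 (- s) = half_line_transform 0 s.
Proof.
  unfold half_line_transform.
  rewrite (Lim_ext (fun b => truncated_transform 0 b (- s))
                   (fun b => truncated_transform 0 b s)); [reflexivity|].
  intros b. unfold truncated_transform. apply RInt_ext. intros u _.
  rewrite !Rplus_0_r, <- (cos_neg (s * u)), Ropp_mult_distr_l. reflexivity.
Qed.

Lemma half_line_transform_odd (s : R) :
  half_line_transform (- (PI / 2)) (- s) = - half_line_transform (- (PI / 2)) s.
Proof.
  unfold half_line_transform.
  rewrite (Lim_ext_loc (fun b => - truncated_transform (- (PI / 2)) b s)
    (fun b => truncated_transform (- (PI / 2)) b (- s))).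
  - rewrite Lim_opp. destruct (Lim _ p_infty); simpl; try ring.
  - exists 0. intros b Hb. unfold truncated_transform.
    rewrite <- (RInt_opp (V := R_CompleteNormedModule))
      by (apply ex_RInt_half_cos; lra).
    apply RInt_ext. intros u _. unfold opp; simpl.
    replace (- s * u + - (PI / 2)) with (- (s * u + - (PI / 2) + PI)) by field.
    rewrite cos_neg, neg_cos. ring.
Qed.

(** * Dirichlet integrals on a half-line *)

(** The kernel [T sinc(Tu)] is [sin(Tu)/u]. *)
Definition sinc_transform (b T : R) : R :=
  RInt (fun u => h u * (T * sinc (T * u))) 0 b.

Lemma ex_RInt_half_sinc (T a b : R) :
  0 <= a -> a <= b -> ex_RInt (fun u => h u * (T * sinc (T * u))) a b.
Proof.
  intros Ha Hab. apply ex_RInt_controlled_mult with W (Rabs T) (Rabs T * Rabs T).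
  - exact Hab.
  - apply half_line_controlled, Ha.
  - apply sinc_kernel_bounded_lipschitz.
Qed.

(** Fubini's theorem for the rectangle [[S, T] x [0, b]], obtained by
    differentiating [sinc_transform b] under the integral sign. *)
Lemma truncated_transform_RInt (b S T : R) :
  0 <= b ->
  RInt (truncated_transform 0 b) S T = sinc_transform b T - sinc_transform b S.
Proof.
  intros Hb. apply is_RInt_unique.
  apply (is_RInt_derive (V := R_CompleteNormedModule) (sinc_transform b)).
  - intros s _. unfold truncated_transform.
    apply (is_derive_RInt_weighted h (fun r t => r * sinc (r * t))
             (fun r t => cos (r * t + 0)) 0 b bound b).
    + exact Hb.
    + intros t Ht. apply half_line_bounded, Ht.
    + intros r t. rewrite Rplus_0_r. apply is_derive_mult_sinc.
    + intros r r' t Ht. eapply Rle_trans; [apply cos_lipschitz|].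
      replace (r' * t + 0 - (r * t + 0)) with (t * (r' - r)) by ring.
      rewrite Rabs_mult, (Rabs_pos_eq t) by lra.
      apply Rmult_le_compat_r; [apply Rabs_pos|lra].
    + intros r. apply ex_RInt_half_sinc; lra.
    + intros r. apply ex_RInt_half_cos; lra.
  - intros s _. destruct (truncated_transform_lipschitz 0 b Hb) as (K & L & H).
    exact (bounded_lipschitz_continuous _ _ _ _ H).
Qed.

Lemma bound_nonneg : 0 <= bound.
Proof. eapply Rle_trans; [apply Rabs_pos|]. apply (half_line_bounded 0). lra. Qed.

Lemma RInt_half_sinc_short (T a b : R) :
  0 < T -> 0 <= a -> a <= b ->
  Rabs (RInt (fun u => h u * (T * sinc (T * u))) a b) <= (b - a) * (bound * T).
Proof.
  intros HT Ha Hab. apply abs_RInt_le_const; [exact Hab|apply ex_RInt_half_sinc; assumption|].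
  intros t Ht. rewrite Rabs_mult.
  apply Rmult_le_compat; [apply Rabs_pos|apply Rabs_pos|apply half_line_bounded; lra|].
  apply Rle_trans with (Rabs T); [apply (proj1 (sinc_kernel_bounded_lipschitz T))|].
  rewrite Rabs_pos_eq; lra.
Qed.

(** Cut at a point [A] beyond which [h] is small and varies little: on [[0, A]]
    the kernel is at most [S], and on the tail its primitive [Si(Su)] is at most
    [PI]. *)
Lemma sinc_transform_small_frequency (eps : R) :
  0 < eps -> exists d A, 0 < d /\ 0 < A /\ forall S b,
    0 < S -> S <= d -> A <= b -> Rabs (sinc_transform b S) <= eps.
Proof.
  intros Heps. assert (HPI := PI_RGT_0). assert (HB := bound_nonneg).
  destruct (half_line_tail (eps / (2 * PI))) as (A & HA & HAt).
  { apply Rdiv_lt_0_compat; lra. }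
  assert (Hd : 0 < eps / (2 * (A * (bound + 1)))) by (apply Rdiv_lt_0_compat; nra).
  exists (eps / (2 * (A * (bound + 1)))), A. split; [exact Hd|]. split; [exact HA|].
  intros S b HS HSd Hb. unfold sinc_transform.
  rewrite <- (RInt_Chasles (V := R_CompleteNormedModule) _ 0 A b)
    by (apply ex_RInt_half_sinc; lra).
  unfold plus; simpl. eapply Rle_trans; [apply Rabs_triang|].
  replace eps with (eps / 2 + PI * (eps / (2 * PI))) by (field; lra).
  apply Rplus_le_compat.
  - eapply Rle_trans; [apply RInt_half_sinc_short; lra|].
    apply Rle_div_r in HSd; [|nra]. nra.
  - eapply Rle_trans.
    + apply (oscillatory_integral_bound h W (fun u => S * sinc (S * u))
               (fun u => sine_integral (S * u) - 0) A b (Rabs S) (Rabs S * Rabs S) PI).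
      * apply half_line_controlled. lra.
      * apply sinc_kernel_bounded_lipschitz.
      * intros t _. apply is_derive_sine_integral_scaled.
      * intros t Ht. rewrite Rminus_0_r. apply sine_integral_bound.
        apply Rmult_le_pos; lra.
      * exact Hb.
    + apply Rmult_le_compat_l; [lra|]. apply HAt; lra.
Qed.

Section RightLimit.

Variable h0 : R.
Hypothesis Hright : filterlim h (at_right 0) (locally h0).

(** The value [h(0)] is arbitrary, hence the strict inequalities [0 < u]. *)
Lemma half_line_near_0 (eps : R) :
  0 < eps -> exists d, 0 < d /\ d <= 1 /\
    (forall u, 0 < u -> u <= d -> Rabs (h u - h0) <= eps) /\
    (forall u v, 0 < u -> u <= v -> v <= d -> W v - W u <= eps).
Proof.
  intros Heps.
  destruct (bounded_monotone_right W 0 (- M) eps) as (d1 & Hd1 & H1).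
  - intros u v Hu Huv. apply half_line_monotone; lra.
  - intros u Hu. assert (H := HW u ltac:(lra)). apply Rabs_le_between in H. lra.
  - exact Heps.
  - apply (proj1 (filterlim_locally _ _)) with (eps := mkposreal eps Heps) in Hright.
    destruct Hright as [d2 H2].
    exists (Rmin 1 (Rmin d1 (d2 / 2))).
    assert (Hd2 := is_pos_div_2 d2). simpl in Hd2.
    assert (K1 := Rmin_l 1 (Rmin d1 (d2 / 2))). assert (K2 := Rmin_r 1 (Rmin d1 (d2 / 2))).
    assert (K3 := Rmin_l d1 (d2 / 2)). assert (K4 := Rmin_r d1 (d2 / 2)).
    split; [repeat apply Rmin_glb_lt; lra|]. split; [exact K1|]. split.
    + intros u Hu Hud. left. apply (H2 u); [|exact Hu].
      change (Rabs (u - 0) < d2). rewrite Rminus_0_r, Rabs_pos_eq; lra.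
    + intros u v Hu Huv Hv. apply H1; lra.
Qed.

(** The integral of [(h - h0) T sinc(Tu)] over [[c, d]] is bounded independently
    of [T] and of [c > 0] by the oscillation of [h] on [(0, d]]; the piece over
    [[0, c]] disappears as [c] tends to [0] with [T] fixed. *)
Lemma sinc_transform_near_0 (T d eta : R) :
  0 < T -> 0 < d -> 0 < eta ->
  (forall u, 0 < u -> u <= d -> Rabs (h u - h0) <= eta) ->
  (forall u v, 0 < u -> u <= v -> v <= d -> W v - W u <= eta) ->
  Rabs (sinc_transform d T - h0 * sine_integral (T * d)) <= 3 * PI * eta.
Proof.
  intros HT Hd Heta H1 H2.
  set (phi := fun u => T * sinc (T * u)).
  assert (Hc0 : forall a b, 0 <= a -> controlled (fun u => h u - h0) W a b).
  { intros a b Ha x y Hx Hxy Hy. replace (h y - h0 - (h x - h0)) with (h y - h x) by ring.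
    apply Hh; lra. }
  assert (Hphi : bounded_lipschitz phi (Rabs T) (Rabs T * Rabs T))
    by apply sinc_kernel_bounded_lipschitz.
  assert (Hex : forall a b, 0 <= a -> a <= b -> ex_RInt (fun u => (h u - h0) * phi u) a b).
  { intros a b Ha Hab.
    apply ex_RInt_controlled_mult with W (Rabs T) (Rabs T * Rabs T); [exact Hab| |exact Hphi].
    apply Hc0, Ha. }
  assert (HI : RInt phi 0 d = sine_integral (T * d)).
  { apply is_RInt_unique.
    replace (sine_integral (T * d))
      with (minus (sine_integral (T * d) - 0) (sine_integral (T * 0) - 0))
      by (rewrite Rmult_0_r, sine_integral_0; unfold minus, plus, opp; simpl; ring).
    apply (is_RInt_derive (V := R_CompleteNormedModule) (fun u => sine_integral (T * u) - 0)).
    - intros x _. apply is_derive_sine_integral_scaled.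
    - intros x _. exact (bounded_lipschitz_continuous _ _ _ _ Hphi). }
  assert (Hsplit : sinc_transform d T - h0 * sine_integral (T * d)
                   = RInt (fun u => (h u - h0) * phi u) 0 d).
  { rewrite <- HI. unfold sinc_transform.
    assert (Hp : ex_RInt phi 0 d) by exact (ex_RInt_bounded_lipschitz _ _ _ _ _ Hphi).
    rewrite <- (RInt_scal (V := R_CompleteNormedModule) phi) by exact Hp.
    rewrite <- (RInt_minus (V := R_CompleteNormedModule)
      (fun u => h u * (T * sinc (T * u))) (fun u => scal h0 (phi u))).
    - apply RInt_ext. intros u _. unfold phi, scal; simpl; unfold mult; simpl.
      symmetry. apply Rmult_minus_distr_r.
    - apply ex_RInt_half_sinc; lra.
    - apply (ex_RInt_scal (V := R_NormedModule)), Hp. }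
  rewrite Hsplit. clear Hsplit HI.
  apply Rle_plus_epsilon. intros e He.
  assert (HB := bound_nonneg). assert (Hh0 := Rabs_pos h0).
  set (K := (bound + Rabs h0 + 1) * T).
  assert (HK : 0 < K) by (apply Rmult_lt_0_compat; lra).
  set (c := Rmin d (e / K)).
  assert (Hc : 0 < c) by (apply Rmin_glb_lt; [exact Hd|apply Rdiv_lt_0_compat; assumption]).
  assert (Hcd : c <= d) by apply Rmin_l.
  assert (Hce : c * K <= e) by (apply Rle_div_r; [exact HK|apply Rmin_r]).
  rewrite <- (RInt_Chasles (V := R_CompleteNormedModule) _ 0 c d) by (apply Hex; lra).
  unfold plus; simpl. eapply Rle_trans; [apply Rabs_triang|].
  rewrite Rplus_comm. apply Rplus_le_compat.
  - eapply Rle_trans.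
    + apply (oscillatory_integral_bound (fun u => h u - h0) W phi
               (fun u => sine_integral (T * u) - 0) c d (Rabs T) (Rabs T * Rabs T) PI).
      * apply Hc0; lra.
      * exact Hphi.
      * intros t _. apply is_derive_sine_integral_scaled.
      * intros t Ht. rewrite Rminus_0_r. apply sine_integral_bound. apply Rmult_le_pos; lra.
      * exact Hcd.
    + assert (K1 := H1 c ltac:(lra) ltac:(lra)). assert (K2 := H1 d ltac:(lra) ltac:(lra)).
      assert (K3 := H2 c d ltac:(lra) ltac:(lra) ltac:(lra)).
      assert (HPI := PI_RGT_0). nra.
  - apply Rle_trans with ((c - 0) * ((bound + Rabs h0) * T)); [|unfold K in Hce; nra].
    apply abs_RInt_le_const; [lra|apply Hex; lra|].
    intros t Ht. rewrite Rabs_mult.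
    apply Rmult_le_compat; [apply Rabs_pos|apply Rabs_pos| |].
    + eapply Rle_trans; [apply Rabs_triang|]. rewrite Rabs_Ropp.
      apply Rplus_le_compat_r, half_line_bounded; lra.
    + apply Rle_trans with (Rabs T); [apply Hphi|rewrite Rabs_pos_eq; lra].
Qed.

(** On [[0, d]] the previous lemma leaves [h0 Si(Td)]. On [[d, b]] the primitive
    [Si(Tu) - PI/2] of the kernel is uniformly small. *)
Lemma sinc_transform_large_frequency (eps : R) :
  0 < eps -> exists T0, 0 < T0 /\ forall T b,
    T0 <= T -> 1 <= b -> Rabs (sinc_transform b T - h0 * (PI / 2)) <= eps.
Proof.
  intros Heps. assert (HPI := PI_RGT_0). assert (HB := bound_nonneg).
  assert (Hh0 := Rabs_pos h0).
  assert (HM : 0 <= M) by (eapply Rle_trans; [apply Rabs_pos|apply (HW 0); lra]).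
  set (eta := eps / (6 * PI)).
  assert (Heta : 0 < eta) by (apply Rdiv_lt_0_compat; lra).
  destruct (half_line_near_0 eta Heta) as (d & Hd & Hd1 & H1 & H2).
  (* The total weight of the errors proportional to [|Si - PI/2|], plus [1] to
     make it positive. *)
  set (K := Rabs h0 + (2 * bound + 2 * M) + 1).
  assert (HK : 0 < K) by (unfold K; lra).
  destruct (sine_integral_limit (eps / 2 / K)) as (A & HA & HAl).
  { apply Rdiv_lt_0_compat; lra. }
  assert (HAd : 0 < A / d) by (apply Rdiv_lt_0_compat; assumption).
  exists (A / d). split; [exact HAd|].
  intros T b HT Hb. apply Rle_div_l in HT; [|exact Hd].
  assert (HT0 : 0 < T) by nra.
  set (q := eps / 2 / K) in *.
  assert (Hq : 0 < q) by (unfold q; apply Rdiv_lt_0_compat; lra).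
  assert (E1 := sinc_transform_near_0 T d eta HT0 Hd Heta H1 H2).
  assert (E2 : Rabs (h0 * sine_integral (T * d) - h0 * (PI / 2)) <= Rabs h0 * q).
  { rewrite <- Rmult_minus_distr_l, Rabs_mult. apply Rmult_le_compat_l; [exact Hh0|].
    apply HAl. lra. }
  assert (E3 : Rabs (RInt (fun u => h u * (T * sinc (T * u))) d b) <= q * (2 * bound + 2 * M)).
  { eapply Rle_trans.
    - apply (oscillatory_integral_bound h W (fun u => T * sinc (T * u))
               (fun u => sine_integral (T * u) - PI / 2) d b (Rabs T) (Rabs T * Rabs T) q).
      + apply half_line_controlled; lra.
      + apply sinc_kernel_bounded_lipschitz.
      + intros t _. apply is_derive_sine_integral_scaled.
      + intros t Ht. apply HAl. nra.
      + lra.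
    - apply Rmult_le_compat_l; [lra|].
      assert (K1 := half_line_bounded d ltac:(lra)). assert (K2 := half_line_bounded b ltac:(lra)).
      assert (K3 := half_line_variation d b ltac:(lra) ltac:(lra)). lra. }
  assert (Hsplit : sinc_transform b T - h0 * (PI / 2) =
    (sinc_transform d T - h0 * sine_integral (T * d))
    + (h0 * sine_integral (T * d) - h0 * (PI / 2))
    + RInt (fun u => h u * (T * sinc (T * u))) d b).
  { unfold sinc_transform.
    rewrite <- (RInt_Chasles (V := R_CompleteNormedModule) _ 0 d b)
      by (apply ex_RInt_half_sinc; lra).
    unfold plus; simpl. ring. }
  rewrite Hsplit.
  eapply Rle_trans; [apply Rabs_triang|].
  assert (E4 := Rabs_triang (sinc_transform d T - h0 * sine_integral (T * d))
                            (h0 * sine_integral (T * d) - h0 * (PI / 2))).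
  assert (E5 : 3 * PI * eta = eps / 2) by (unfold eta; field; lra).
  assert (E6 : q * K = eps / 2) by (unfold q; field; lra).
  unfold K in E6. lra.
Qed.

Lemma half_line_inversion (eps : R) :
  0 < eps -> exists S0 T0, 0 < S0 /\ 0 < T0 /\ forall S T,
    0 < S -> S <= S0 -> T0 <= T -> S <= T ->
    Rabs (RInt (half_line_transform 0) S T - h0 * (PI / 2)) <= eps.
Proof.
  intros Heps.
  destruct (sinc_transform_small_frequency (eps / 2)) as (S0 & A & HS0 & _ & HS); [lra|].
  destruct (sinc_transform_large_frequency (eps / 2)) as (T0 & HT0 & HT); [lra|].
  exists S0, T0. split; [exact HS0|]. split; [exact HT0|].
  intros S T HS1 HS2 HT1 HST.
  apply Rle_plus_epsilon. intros e He.
  destruct (half_line_transform_RInt 0 S T HS1 HST) as [_ Hl].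
  apply is_lim_seq_spec in Hl. destruct (Hl (mkposreal e He)) as [N HN]. simpl in HN.
  destruct (INR_unbounded (Rmax 1 A)) as [N' HN'].
  assert (Hn := HN (Nat.max N N') (Nat.le_max_l _ _)).
  assert (Hn' := le_INR _ _ (Nat.le_max_r N N')).
  set (n := Nat.max N N') in *.
  assert (K1 := Rmax_l 1 A). assert (K2 := Rmax_r 1 A).
  rewrite truncated_transform_RInt in Hn by apply pos_INR.
  assert (E1 := HS S (INR n) HS1 HS2 ltac:(lra)).
  assert (E2 := HT T (INR n) HT1 ltac:(lra)).
  set (J := RInt (half_line_transform 0) S T : R) in *.
  apply Rabs_le_between in E1. apply Rabs_le_between in E2.
  apply Rabs_lt_between in Hn. apply Rabs_le. lra.
Qed.

End RightLimit.

End HalfLine.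

(** * Integrals of complex-valued functions *)

Lemma expi_mult (u v : R) : Cmult (expi u) (expi v) = expi (u + v).
Proof.
  unfold expi, Cmult; simpl. rewrite cos_plus, sin_plus. f_equal; ring.
Qed.

Lemma expi_0 : expi 0 = RtoC 1.
Proof. unfold expi. rewrite cos_0, sin_0. reflexivity. Qed.

Lemma expi_mult_RtoC (u r : R) : Cmult (expi u) (RtoC r) = (r * cos u, r * sin u).
Proof. unfold expi, Cmult, RtoC; simpl. f_equal; ring. Qed.

Lemma is_RInt_C (g : R -> C) (a b l1 l2 : R) :
  is_RInt (fun t => fst (g t)) a b l1 -> is_RInt (fun t => snd (g t)) a b l2 ->
  is_RInt (V := C_R_NormedModule) g a b (l1, l2).
Proof. apply (is_RInt_fct_extend_pair (U := R_NormedModule) (V := R_NormedModule)). Qed.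

Lemma is_RInt_Cmult (c : C) (g : R -> C) (a b : R) (l : C) :
  is_RInt (V := C_R_NormedModule) g a b l ->
  is_RInt (V := C_R_NormedModule) (fun t => Cmult c (g t)) a b (Cmult c l).
Proof.
  intros H.
  assert (H1 := is_RInt_fct_extend_fst (U := R_NormedModule) (V := R_NormedModule) g a b l H).
  assert (H2 := is_RInt_fct_extend_snd (U := R_NormedModule) (V := R_NormedModule) g a b l H).
  apply is_RInt_C; simpl.
  - apply (is_RInt_minus (V := R_NormedModule));
      apply (is_RInt_scal (V := R_NormedModule)); assumption.
  - apply (is_RInt_plus (V := R_NormedModule));
      apply (is_RInt_scal (V := R_NormedModule)); assumption.
Qed.

Lemma filterlim_C {T : Type} (F : (T -> Prop) -> Prop) {FF : Filter F}
    (g : T -> C) (l : C) :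
  filterlim (fun t => fst (g t)) F (locally (fst l)) ->
  filterlim (fun t => snd (g t)) F (locally (snd l)) ->
  filterlim g F (locally (T := C_R_NormedModule) l).
Proof.
  intros H1 H2. apply (filterlim_locally (U := C_R_NormedModule)). intros eps.
  assert (K1 := proj1 (filterlim_locally _ _) H1 eps).
  assert (K2 := proj1 (filterlim_locally _ _) H2 eps).
  generalize (filter_and _ _ K1 K2). apply filter_imp.
  intros t [L1 L2]. split; assumption.
Qed.

Lemma Cmult_continuous (c z : C) :
  filterlim (Cmult c) (locally (T := C_R_NormedModule) z)
    (locally (T := C_R_NormedModule) (Cmult c z)).
Proof.
  apply (filterlim_locally (U := C_R_NormedModule)). intros eps.
  set (K := Rabs (fst c) + Rabs (snd c) + 1).
  assert (H1 := Rabs_pos (fst c)). assert (H2 := Rabs_pos (snd c)).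
  assert (HK : 0 < K) by (unfold K; lra).
  assert (Hd : 0 < eps / K) by (apply Rdiv_lt_0_compat; [apply cond_pos|exact HK]).
  assert (Hb : forall p q u v, Rabs p + Rabs q + 1 = K ->
    Rabs u < eps / K -> Rabs v < eps / K -> Rabs (p * u + q * v) < eps).
  { intros p q u v Hpq Hu Hv. eapply Rle_lt_trans; [apply Rabs_triang|].
    rewrite !Rabs_mult. replace (pos eps) with (K * (eps / K)) by (field; lra).
    assert (Hp := Rabs_pos p). assert (Hq := Rabs_pos q). rewrite <- Hpq at 1. nra. }
  exists (mkposreal _ Hd). intros w [Hw1 Hw2].
  change (Rabs (fst w - fst z) < eps / K) in Hw1.
  change (Rabs (snd w - snd z) < eps / K) in Hw2.
  split.
  - change (Rabs (fst c * fst w - snd c * snd w - (fst c * fst z - snd c * snd z)) < eps).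
    replace (fst c * fst w - snd c * snd w - (fst c * fst z - snd c * snd z))
      with (fst c * (fst w - fst z) + (- snd c) * (snd w - snd z)) by ring.
    apply Hb; try assumption. rewrite Rabs_Ropp. reflexivity.
  - change (Rabs (fst c * snd w + snd c * fst w - (fst c * snd z + snd c * fst z)) < eps).
    replace (fst c * snd w + snd c * fst w - (fst c * snd z + snd c * fst z))
      with (fst c * (snd w - snd z) + snd c * (fst w - fst z)) by ring.
    apply Hb; [reflexivity|assumption|assumption].
Qed.

Lemma is_RInt_gen_Cmult (c : C) (g : R -> C) (Fa Fb : (R -> Prop) -> Prop) (l : C)
    {FFa : Filter Fa} {FFb : Filter Fb} :
  is_RInt_gen (V := C_R_NormedModule) g Fa Fb l ->
  is_RInt_gen (V := C_R_NormedModule) (fun t => Cmult c (g t)) Fa Fb (Cmult c l).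
Proof.
  intros H P HP. apply Cmult_continuous in HP. specialize (H _ HP).
  unfold filtermapi in *. revert H. apply filter_imp.
  intros ab (y & Hy & HPy). exists (Cmult c y). split; [|exact HPy].
  apply is_RInt_Cmult, Hy.
Qed.

Lemma filterlim_Rplus {T : Type} (F : (T -> Prop) -> Prop) {FF : Filter F}
    (u v : T -> R) (a b : R) :
  filterlim u F (locally a) -> filterlim v F (locally b) ->
  filterlim (fun t => u t + v t) F (locally (a + b)).
Proof.
  intros Hu Hv. apply (filterlim_comp_2 u v Rplus Hu Hv).
  apply (filterlim_plus (V := R_NormedModule)).
Qed.

Lemma filterlim_Ropp {T : Type} (F : (T -> Prop) -> Prop)
    (u : T -> R) (a : R) :
  filterlim u F (locally a) -> filterlim (fun t => - u t) F (locally (- a)).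
Proof.
  intros Hu. apply (filterlim_comp _ _ _ u Ropp F (locally a) (locally (- a)) Hu).
  apply (filterlim_opp (V := R_NormedModule)).
Qed.

Lemma is_RInt_translate {E : NormedModule R_AbsRing} (g : R -> E) (x a b : R) (l : E) :
  is_RInt (fun u => g (x + u)) (a - x) (b - x) l -> is_RInt g a b l.
Proof.
  intros H.
  apply is_RInt_ext with (fun t => scal 1 (g (x + (1 * t + - x)))).
  - intros t _. replace (x + (1 * t + - x)) with t by ring.
    apply (scal_one (V := E)).
  - apply (is_RInt_comp_lin (fun u => g (x + u)) 1 (- x)).
    rewrite !Rmult_1_l. exact H.
Qed.

Lemma is_RInt_reflect {E : NormedModule R_AbsRing} (g : R -> E) (x a b : R) (l : E) :
  is_RInt (fun u => g (x - u)) (x - b) (x - a) l -> is_RInt g a b l.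
Proof.
  intros H. apply is_RInt_swap in H.
  apply is_RInt_ext with (fun t => opp (scal (-1) (g (x - (-1 * t + x))))).
  - intros t _. replace (x - (-1 * t + x)) with t by ring.
    rewrite <- (scal_opp_l (V := E)).
    assert (Hone : opp ((-1) : R_AbsRing) = one)
      by (unfold opp, one; simpl; apply Ropp_involutive).
    transitivity (scal (one : R_AbsRing) (g t)); [f_equal; exact Hone|].
    apply (scal_one (V := E)).
  - rewrite <- (opp_opp l). apply (is_RInt_opp (V := E)).
    apply (is_RInt_comp_lin (fun u => g (x - u)) (-1) x).
    replace (-1 * a + x) with (x - a) by ring.
    replace (-1 * b + x) with (x - b) by ring. exact H.
Qed.

(** * The Fourier transform centred at a point *)

Definition right_half (f : R -> R) (x u : R) : R := f (x + u).
Definition left_half (f : R -> R) (x u : R) : R := f (x - u).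

(** [cos_part] and [sin_part] are the real and imaginary parts of
    [e^(ixs) fourier f s], with [f] cut at [x]; see [fourier_centred]. *)
Definition cos_part (f : R -> R) (x s : R) : R :=
  half_line_transform (right_half f x) 0 s + half_line_transform (left_half f x) 0 s.
Definition sin_part (f : R -> R) (x s : R) : R :=
  half_line_transform (left_half f x) (- (PI / 2)) s
  - half_line_transform (right_half f x) (- (PI / 2)) s.

Section Line.

Variables (f V : R -> R) (M : R).
Hypothesis Hf : forall x y, x <= y -> Rabs (f y - f x) <= V y - V x.
Hypothesis HV : forall x, Rabs (V x) <= M.
Hypothesis Hm : is_lim f m_infty 0.
Hypothesis Hp : is_lim f p_infty 0.

Lemma right_half_control (x u v : R) : 0 <= u -> u <= v ->
  Rabs (right_half f x v - right_half f x u) <= right_half V x v - right_half V x u.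
Proof. intros Hu Huv. apply Hf. lra. Qed.

Lemma left_half_control (x u v : R) : 0 <= u -> u <= v ->
  Rabs (left_half f x v - left_half f x u) <= - left_half V x v - - left_half V x u.
Proof.
  intros Hu Huv. rewrite Rabs_minus_sym. assert (H := Hf (x - v) (x - u) ltac:(lra)).
  unfold left_half. lra.
Qed.

Lemma right_half_bounded (x u : R) : 0 <= u -> Rabs (right_half V x u) <= M.
Proof. intros _. apply HV. Qed.

Lemma left_half_bounded (x u : R) : 0 <= u -> Rabs (- left_half V x u) <= M.
Proof. intros _. rewrite Rabs_Ropp. apply HV. Qed.

Lemma right_half_vanishes (x : R) : is_lim (right_half f x) p_infty 0.
Proof.
  apply is_lim_spec. intros eps. apply is_lim_spec in Hp. destruct (Hp eps) as [N HN].
  exists (N - x). intros u Hu. apply HN. lra.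
Qed.

Lemma left_half_vanishes (x : R) : is_lim (left_half f x) p_infty 0.
Proof.
  apply is_lim_spec. intros eps. apply is_lim_spec in Hm. destruct (Hm eps) as [N HN].
  exists (x - N). intros u Hu. apply HN. lra.
Qed.

Lemma truncated_right_half (x b c s : R) : x <= b ->
  is_RInt (fun t => f t * cos (s * (t - x) + c)) x b
    (truncated_transform (right_half f x) c (b - x) s).
Proof.
  intros Hb.
  apply is_RInt_translate with x. rewrite Rminus_diag.
  apply is_RInt_ext with (fun u => right_half f x u * cos (s * u + c)).
  - intros u _. unfold right_half. replace (x + u - x) with u by ring. reflexivity.
  - apply (RInt_correct (V := R_CompleteNormedModule)).
    apply (ex_RInt_half_cos _ (right_half V x)); [apply right_half_control|lra|lra].
Qed.

Lemma truncated_left_half (x a c s : R) : a <= x ->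
  is_RInt (fun t => f t * cos (s * (x - t) + c)) a x
    (truncated_transform (left_half f x) c (x - a) s).
Proof.
  intros Ha.
  apply is_RInt_reflect with x. rewrite Rminus_diag.
  apply is_RInt_ext with (fun u => left_half f x u * cos (s * u + c)).
  - intros u _. unfold left_half. replace (x - (x - u)) with u by ring. reflexivity.
  - apply (RInt_correct (V := R_CompleteNormedModule)).
    apply (ex_RInt_half_cos _ (fun u => - left_half V x u)); [apply left_half_control|lra|lra].
Qed.

Lemma right_half_limit (x c s : R) : s <> 0 ->
  filterlim (fun ab : R * R => truncated_transform (right_half f x) c (snd ab - x) s)
    (filter_prod (Rbar_locally m_infty) (Rbar_locally p_infty))
    (locally (half_line_transform (right_half f x) c s)).
Proof.
  intros Hs.
  apply (filterlim_comp _ _ _ (fun ab : R * R => snd ab - x)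
    (fun b => truncated_transform (right_half f x) c b s) _ (Rbar_locally p_infty)).
  - apply (filterlim_comp _ _ _ snd (fun b => b - x) _ (Rbar_locally p_infty)).
    + apply filterlim_snd.
    + intros P [N HN]. exists (N + x). intros b Hb. apply HN. lra.
  - apply (half_line_transform_correct _ (right_half V x) M);
      [apply right_half_control|apply right_half_bounded|apply right_half_vanishes|exact Hs].
Qed.

Lemma left_half_limit (x c s : R) : s <> 0 ->
  filterlim (fun ab : R * R => truncated_transform (left_half f x) c (x - fst ab) s)
    (filter_prod (Rbar_locally m_infty) (Rbar_locally p_infty))
    (locally (half_line_transform (left_half f x) c s)).
Proof.
  intros Hs.
  apply (filterlim_comp _ _ _ (fun ab : R * R => x - fst ab)
    (fun b => truncated_transform (left_half f x) c b s) _ (Rbar_locally p_infty)).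
  - apply (filterlim_comp _ _ _ fst (fun b => x - b) _ (Rbar_locally m_infty)).
    + apply filterlim_fst.
    + intros P [N HN]. exists (x - N). intros b Hb. apply HN. lra.
  - apply (half_line_transform_correct _ (fun u => - left_half V x u) M);
      [apply left_half_control|apply left_half_bounded|apply left_half_vanishes|exact Hs].
Qed.

(** The integral over [[a, b]] is the sum of the truncated transforms of the two
    halves, with truncations [x - a] and [b - x] that tend to infinity
    independently. *)
Lemma is_RInt_gen_centred (x s : R) : s <> 0 ->
  is_RInt_gen (V := C_R_NormedModule)
    (fun t => Cmult (expi (x * s)) (fourier_integrand f s t))
    (Rbar_locally m_infty) (Rbar_locally p_infty) (cos_part f x s, sin_part f x s).
Proof.
  intros Hs.
  assert (HE : forall t, Cmult (expi (x * s)) (fourier_integrand f s t)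
    = (f t * cos (s * (x - t)), f t * sin (s * (x - t)))).
  { intros t. unfold fourier_integrand. rewrite Cmult_assoc, expi_mult, expi_mult_RtoC.
    replace (x * s + - (s * t)) with (s * (x - t)) by ring. reflexivity. }
  (* The sine as a cosine with the phase of [sin_part]. *)
  assert (Hsin : forall y, sin y = cos (y + - (PI / 2))).
  { intros y. rewrite <- (cos_neg (y + - (PI / 2))), <- cos_shift. f_equal. ring. }
  apply (filterlimi_lim_ext_loc (fun ab : R * R =>
    (truncated_transform (right_half f x) 0 (snd ab - x) s
       + truncated_transform (left_half f x) 0 (x - fst ab) s,
     truncated_transform (left_half f x) (- (PI / 2)) (x - fst ab) s
       - truncated_transform (right_half f x) (- (PI / 2)) (snd ab - x) s))).
  - apply Filter_prod with (fun a => a < x) (fun b => x < b).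
    + exists x. trivial.
    + exists x. trivial.
    + intros a b Ha Hb. simpl.
      apply is_RInt_ext with (fun t => (f t * cos (s * (x - t)), f t * sin (s * (x - t))) : C).
      { intros t _. symmetry. apply HE. }
      apply is_RInt_C; simpl.
      * rewrite Rplus_comm. apply (is_RInt_Chasles (V := R_NormedModule)) with x.
        -- apply is_RInt_ext with (fun t => f t * cos (s * (x - t) + 0)).
           ++ intros t _. rewrite Rplus_0_r. reflexivity.
           ++ apply truncated_left_half. lra.
        -- apply is_RInt_ext with (fun t => f t * cos (s * (t - x) + 0)).
           ++ intros t _. rewrite Rplus_0_r, <- cos_neg. f_equal. f_equal. ring.
           ++ apply truncated_right_half. lra.
      * apply (is_RInt_Chasles (V := R_NormedModule)) with x.
        -- apply is_RInt_ext with (fun t => f t * cos (s * (x - t) + - (PI / 2))).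
           ++ intros t _. rewrite Hsin. reflexivity.
           ++ apply truncated_left_half. lra.
        -- apply is_RInt_ext with (fun t => opp (f t * cos (s * (t - x) + - (PI / 2)))).
           ++ intros t _. rewrite <- Hsin.
              replace (s * (x - t)) with (- (s * (t - x))) by ring.
              rewrite sin_neg. unfold opp; simpl. ring.
           ++ apply (is_RInt_opp (V := R_NormedModule)), truncated_right_half. lra.
  - apply filterlim_C; simpl.
    + typeclasses eauto.
    + apply filterlim_Rplus; [typeclasses eauto|apply right_half_limit|apply left_half_limit]; exact Hs.
    + apply filterlim_Rplus; [typeclasses eauto|apply left_half_limit; exact Hs|].
      apply filterlim_Ropp, right_half_limit, Hs.
Qed.

Lemma is_RInt_gen_fourier (x s : R) : s <> 0 ->
  is_RInt_gen (V := C_R_NormedModule) (fourier_integrand f s)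
    (Rbar_locally m_infty) (Rbar_locally p_infty)
    (Cmult (expi (- (x * s))) (cos_part f x s, sin_part f x s)).
Proof.
  intros Hs.
  apply (is_RInt_gen_ext (V := C_R_NormedModule)
    (fun t => Cmult (expi (- (x * s))) (Cmult (expi (x * s)) (fourier_integrand f s t)))).
  - apply filter_forall. intros ab t _.
    rewrite Cmult_assoc, expi_mult, Rplus_opp_l, expi_0, Cmult_1_l. reflexivity.
  - apply is_RInt_gen_Cmult; [typeclasses eauto|typeclasses eauto|].
    apply is_RInt_gen_centred, Hs.
Qed.

Lemma ex_fourier_nonzero (s : R) : s <> 0 -> ex_fourier f s.
Proof. intros Hs. eexists. apply (is_RInt_gen_fourier 0), Hs. Qed.

Lemma fourier_correct (s : R) : s <> 0 ->
  is_RInt_gen (V := C_R_NormedModule) (fourier_integrand f s)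
    (Rbar_locally m_infty) (Rbar_locally p_infty) (fourier f s).
Proof.
  intros Hs. unfold fourier.
  rewrite (is_RInt_gen_unique (V := C_R_CompleteNormedModule) _ _ (is_RInt_gen_fourier 0 s Hs)).
  apply is_RInt_gen_fourier, Hs.
Qed.

Lemma fourier_centred (x s : R) : s <> 0 ->
  Cmult (expi (x * s)) (fourier f s) = (cos_part f x s, sin_part f x s).
Proof.
  intros Hs. unfold fourier.
  rewrite (is_RInt_gen_unique (V := C_R_CompleteNormedModule) _ _ (is_RInt_gen_fourier x s Hs)).
  rewrite Cmult_assoc, expi_mult, Rplus_opp_r, expi_0, Cmult_1_l. reflexivity.
Qed.

Lemma cos_part_even (x s : R) : cos_part f x (- s) = cos_part f x s.
Proof. unfold cos_part. rewrite !half_line_transform_even. reflexivity. Qed.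

Lemma sin_part_odd (x s : R) : sin_part f x (- s) = - sin_part f x s.
Proof.
  unfold sin_part.
  rewrite (half_line_transform_odd (right_half f x) (right_half V x)) by apply right_half_control.
  rewrite (half_line_transform_odd (left_half f x) (fun u => - left_half V x u)) by apply left_half_control.
  ring.
Qed.

Lemma ex_RInt_right_transform (x c S T : R) : 0 < S -> S <= T ->
  ex_RInt (half_line_transform (right_half f x) c) S T.
Proof.
  intros HS HT. apply (half_line_transform_RInt _ (right_half V x) M);
    [apply right_half_control|apply right_half_bounded|apply right_half_vanishes|exact HS|exact HT].
Qed.

Lemma ex_RInt_left_transform (x c S T : R) : 0 < S -> S <= T ->
  ex_RInt (half_line_transform (left_half f x) c) S T.
Proof.
  intros HS HT. apply (half_line_transform_RInt _ (fun u => - left_half V x u) M);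
    [apply left_half_control|apply left_half_bounded|apply left_half_vanishes|exact HS|exact HT].
Qed.

Lemma ex_RInt_cos_part (x S T : R) : 0 < S -> S <= T -> ex_RInt (cos_part f x) S T.
Proof.
  intros HS HT. apply (ex_RInt_plus (V := R_NormedModule));
    [apply ex_RInt_right_transform|apply ex_RInt_left_transform]; assumption.
Qed.

Lemma ex_RInt_sin_part (x S T : R) : 0 < S -> S <= T -> ex_RInt (sin_part f x) S T.
Proof.
  intros HS HT. apply (ex_RInt_minus (V := R_NormedModule));
    [apply ex_RInt_left_transform|apply ex_RInt_right_transform]; assumption.
Qed.

(** The cosine part is even in [s] and the sine part odd: over the two components
    of the annulus the former doubles and the latter cancels. *)
Lemma centred_annulus_integral (x S T : R) : 0 < S -> S <= T ->
  is_RInt_annulus (fun s => Cmult (expi (x * s)) (fourier f s)) 0 S T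
    (RtoC (2 * RInt (cos_part f x) S T)).
Proof.
  intros HS HT.
  set (A := RInt (cos_part f x) S T). set (B := RInt (sin_part f x) S T).
  assert (HA : is_RInt (cos_part f x) S T A)
    by (apply (RInt_correct (V := R_CompleteNormedModule)), ex_RInt_cos_part; assumption).
  assert (HB : is_RInt (sin_part f x) S T B)
    by (apply (RInt_correct (V := R_CompleteNormedModule)), ex_RInt_sin_part; assumption).
  exists (A, - B), (A, B). split; [|split].
  - apply is_RInt_ext with (fun s => (cos_part f x s, sin_part f x s) : C).
    { intros s. rewrite Rmin_left, Rmax_right by lra. intros Hs.
      symmetry. apply fourier_centred. lra. }
    apply is_RInt_C; simpl; apply is_RInt_reflect with 0;
      replace (0 - (0 - S)) with S by ring; replace (0 - (0 - T)) with T by ring.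
    + apply is_RInt_ext with (2 := HA). intros s _.
      rewrite Rminus_0_l. symmetry. apply cos_part_even.
    + apply is_RInt_ext with (fun s => opp (sin_part f x s)).
      * intros s _. rewrite Rminus_0_l. symmetry. apply sin_part_odd.
      * apply (is_RInt_opp (V := R_NormedModule)), HB.
  - rewrite !Rplus_0_l.
    apply is_RInt_ext with (fun s => (cos_part f x s, sin_part f x s) : C).
    { intros s. rewrite Rmin_left by lra. intros Hs.
      symmetry. apply fourier_centred. lra. }
    apply is_RInt_C; assumption.
  - unfold Cplus, RtoC; simpl. f_equal; ring.
Qed.

(** Each half contributes its limit at [0] times [PI/2]. *)
Lemma cos_part_inversion (x fl fr eps : R) :
  filterlim f (at_left x) (locally fl) -> filterlim f (at_right x) (locally fr) ->
  0 < eps -> exists S0 T0, 0 < S0 /\ 0 < T0 /\ forall S T,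
    0 < S -> S <= S0 -> T0 <= T -> S <= T ->
    Rabs (2 * RInt (cos_part f x) S T - PI * (fl + fr)) <= eps.
Proof.
  intros Hl Hr Heps.
  destruct (half_line_inversion (right_half f x) (right_half V x) M) with (h0 := fr) (eps := eps / 4)
    as (S1 & T1 & HS1 & HT1 & H1);
    [apply right_half_control|apply right_half_bounded|apply right_half_vanishes| |lra|].
  { apply (filterlim_comp _ _ _ (fun u => x + u) f _ (at_right x)); [|exact Hr].
    intros P [d HP]. exists d. intros u Hu Hu0. apply HP; [|lra].
    change (Rabs (x + u - x) < d). change (Rabs (u - 0) < d) in Hu.
    replace (x + u - x) with (u - 0) by ring. exact Hu. }
  destruct (half_line_inversion (left_half f x) (fun u => - left_half V x u) M)
    with (h0 := fl) (eps := eps / 4)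
    as (S2 & T2 & HS2 & HT2 & H2);
    [apply left_half_control|apply left_half_bounded|apply left_half_vanishes| |lra|].
  { apply (filterlim_comp _ _ _ (fun u => x - u) f _ (at_left x)); [|exact Hl].
    intros P [d HP]. exists d. intros u Hu Hu0. apply HP; [|lra].
    change (Rabs (x - u - x) < d). change (Rabs (u - 0) < d) in Hu.
    replace (x - u - x) with (- (u - 0)) by ring. rewrite Rabs_Ropp. exact Hu. }
  exists (Rmin S1 S2), (Rmax T1 T2).
  split; [apply Rmin_glb_lt; assumption|].
  assert (K1 := Rmin_l S1 S2). assert (K2 := Rmin_r S1 S2).
  assert (K3 := Rmax_l T1 T2). assert (K4 := Rmax_r T1 T2).
  split; [lra|].
  intros S T HS HS0 HT HST.
  specialize (H1 S T HS ltac:(lra) ltac:(lra) HST).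
  specialize (H2 S T HS ltac:(lra) ltac:(lra) HST).
  assert (Hsum : RInt (cos_part f x) S T =
    RInt (half_line_transform (right_half f x) 0) S T +
    RInt (half_line_transform (left_half f x) 0) S T).
  { apply (RInt_plus (V := R_CompleteNormedModule));
      [apply ex_RInt_right_transform|apply ex_RInt_left_transform]; assumption. }
  rewrite Hsum. apply Rabs_le_between in H1. apply Rabs_le_between in H2.
  apply Rabs_le. lra.
Qed.

End Line.

(** * One-sided limits *)

Lemma controlled_right_limit (f V : R -> R) (M x : R) :
  (forall u v, u <= v -> Rabs (f v - f u) <= V v - V u) -> (forall u, Rabs (V u) <= M) ->
  exists l : R, filterlim f (at_right x) (locally l).
Proof.
  intros Hf HV. apply (filterlim_locally_cauchy (U := R_CompleteSpace)). intros eps.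
  destruct (bounded_monotone_right V x (- M) (eps / 2)) as (d & Hd & H).
  - intros u v _ Huv. assert (H := Hf u v Huv). assert (H' := Rabs_pos (f v - f u)). lra.
  - intros u _. assert (H := HV u). apply Rabs_le_between in H. lra.
  - apply is_pos_div_2.
  - exists (fun u => x < u <= x + d). split.
    + exists (mkposreal d Hd). intros u Hu Hxu.
      change (Rabs (u - x) < d) in Hu. apply Rabs_lt_between in Hu. lra.
    + assert (He := cond_pos eps).
      assert (Hle : forall u v, x < u -> u <= v -> v <= x + d -> Rabs (f v - f u) < eps).
      { intros u v Hu Huv Hv. assert (H1 := H u v Hu Huv Hv). assert (H2 := Hf u v Huv). lra. }
      intros u v Hu Hv. change (Rabs (f v - f u) < eps).
      destruct (Rle_dec u v); [apply Hle; lra|].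
      rewrite Rabs_minus_sym. apply Hle; lra.
Qed.

Lemma controlled_left_limit (f V : R -> R) (M x : R) :
  (forall u v, u <= v -> Rabs (f v - f u) <= V v - V u) -> (forall u, Rabs (V u) <= M) ->
  exists l : R, filterlim f (at_left x) (locally l).
Proof.
  intros Hf HV.
  destruct (controlled_right_limit (fun t => f (- t)) (fun t => - V (- t)) M (- x)) as [l Hl].
  - intros u v Huv. rewrite Rabs_minus_sym. assert (H := Hf (- v) (- u) ltac:(lra)). lra.
  - intros u. rewrite Rabs_Ropp. apply HV.
  - exists l. apply filterlim_ext with (fun t => f (- - t)).
    + intros t. rewrite Ropp_involutive. reflexivity.
    + apply (filterlim_comp _ _ _ Ropp (fun t => f (- t)) _ (at_right (- x)));
        [apply filterlim_Ropp_left|exact Hl].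
Qed.

(** * Modulation and inversion on an annulus *)

Lemma annulus_translate (g : R -> C) (a S T : R) (l : C) :
  is_RInt_annulus (fun s => g (a + s)) 0 S T l -> is_RInt_annulus g a S T l.
Proof.
  intros (l1 & l2 & H1 & H2 & ->). exists l1, l2.
  rewrite !Rplus_0_l, !Rminus_0_l in *. split; [|split; [|reflexivity]].
  - apply is_RInt_translate with a.
    replace (a - T - a) with (- T) by ring. replace (a - S - a) with (- S) by ring. exact H1.
  - apply is_RInt_translate with a.
    replace (a + S - a) with S by ring. replace (a + T - a) with T by ring. exact H2.
Qed.

Lemma annulus_ext (g k : R -> C) (S T : R) (l : C) :
  0 < S -> S <= T -> (forall s, s <> 0 -> g s = k s) ->
  is_RInt_annulus g 0 S T l -> is_RInt_annulus k 0 S T l.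
Proof.
  intros HS HT He (l1 & l2 & H1 & H2 & ->). exists l1, l2. split; [|split; [|reflexivity]].
  - apply is_RInt_ext with (2 := H1). intros s. rewrite Rmax_right by lra. intros Hs.
    apply He. lra.
  - apply is_RInt_ext with (2 := H2). intros s. rewrite Rmin_left by lra. intros Hs.
    apply He. lra.
Qed.

Lemma annulus_plus (g k : R -> C) (a S T : R) (l m : C) :
  is_RInt_annulus g a S T l -> is_RInt_annulus k a S T m ->
  is_RInt_annulus (fun s => Cplus (g s) (k s)) a S T (Cplus l m).
Proof.
  intros (l1 & l2 & H1 & H2 & ->) (m1 & m2 & K1 & K2 & ->).
  exists (Cplus l1 m1), (Cplus l2 m2).
  split; [apply (is_RInt_plus (V := C_R_NormedModule)); assumption|].
  split; [apply (is_RInt_plus (V := C_R_NormedModule)); assumption|]. ring.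
Qed.

Lemma annulus_Cmult (c : C) (g : R -> C) (a S T : R) (l : C) :
  is_RInt_annulus g a S T l ->
  is_RInt_annulus (fun s => Cmult c (g s)) a S T (Cmult c l).
Proof.
  intros (l1 & l2 & H1 & H2 & ->). exists (Cmult c l1), (Cmult c l2).
  split; [apply is_RInt_Cmult, H1|]. split; [apply is_RInt_Cmult, H2|]. ring.
Qed.

Lemma one_sided_mult (f : R -> R) (F : (R -> Prop) -> Prop) {FF : Filter F}
    (phi : R -> R) (x l : R) :
  filter_le F (locally x) -> continuous phi x -> filterlim f F (locally l) ->
  filterlim (fun t => f t * phi t) F (locally (l * phi x)).
Proof.
  intros HF Hphi Hl.
  apply (filterlim_comp_2 (H := locally (phi x)) f phi Rmult Hl).
  - apply filterlim_filter_le_1 with (2 := Hphi). exact HF.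
  - apply (filterlim_mult (K := R_AbsRing)).
Qed.

Lemma vanishing_mult (f phi : R -> R) (x : Rbar) :
  (forall t, Rabs (phi t) <= 1) -> is_lim f x 0 -> is_lim (fun t => f t * phi t) x 0.
Proof.
  intros Hphi Hf. apply is_lim_spec in Hf. apply is_lim_spec. intros eps.
  generalize (Hf eps). apply filter_imp. intros t Ht.
  rewrite Rminus_0_r in *. rewrite Rabs_mult.
  assert (H := Hphi t). assert (H' := Rabs_pos (f t)). nra.
Qed.

(** The function [e^(-iat) f(t)] has real part [re_mod] and imaginary part
    [im_mod]. One [V] controls both, since each increment is at most that of the
    complex function. *)
Section Modulation.

Variables (f V : R -> R) (M a : R).

Definition re_mod (t : R) : R := f t * cos (- (a * t)).
Definition im_mod (t : R) : R := f t * sin (- (a * t)).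

Hypothesis Hre : forall u v, u <= v -> Rabs (re_mod v - re_mod u) <= V v - V u.
Hypothesis Him : forall u v, u <= v -> Rabs (im_mod v - im_mod u) <= V v - V u.
Hypothesis HV : forall u, Rabs (V u) <= M.
Hypothesis Hm : is_lim f m_infty 0.
Hypothesis Hp : is_lim f p_infty 0.

Lemma re_mod_vanishes (b : Rbar) : is_lim f b 0 -> is_lim re_mod b 0.
Proof. apply vanishing_mult. intros t. apply Rabs_cos_le_1. Qed.

Lemma im_mod_vanishes (b : Rbar) : is_lim f b 0 -> is_lim im_mod b 0.
Proof. apply vanishing_mult. intros t. apply Rabs_sin_le_1. Qed.

Lemma fourier_modulation (s : R) : s <> 0 ->
  fourier f (a + s) = Cplus (fourier re_mod s) (Cmult Ci (fourier im_mod s)).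
Proof.
  intros Hs. unfold fourier at 1.
  apply (is_RInt_gen_unique (V := C_R_CompleteNormedModule)).
  apply (is_RInt_gen_ext (V := C_R_NormedModule)
    (fun t => plus (fourier_integrand re_mod s t) (Cmult Ci (fourier_integrand im_mod s t)))).
  - apply filter_forall. intros ab t _. unfold fourier_integrand.
    replace (- ((a + s) * t)) with (- (s * t) + - (a * t)) by ring.
    rewrite <- expi_mult, <- Cmult_assoc, (expi_mult_RtoC (- (a * t))).
    change (Cplus (Cmult (expi (- (s * t))) (RtoC (re_mod t)))
      (Cmult Ci (Cmult (expi (- (s * t))) (RtoC (im_mod t))))
      = Cmult (expi (- (s * t))) (re_mod t, im_mod t)).
    replace ((re_mod t, im_mod t) : C) with (Cplus (RtoC (re_mod t)) (Cmult Ci (RtoC (im_mod t))));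
      [ring|].
    unfold Cplus, Cmult, Ci, RtoC; simpl. f_equal; ring.
  - apply (is_RInt_gen_plus (V := C_R_NormedModule)).
    + apply (fourier_correct re_mod V M); auto using re_mod_vanishes.
    + apply is_RInt_gen_Cmult; [typeclasses eauto|typeclasses eauto|].
      apply (fourier_correct im_mod V M); auto using im_mod_vanishes.
Qed.

(** The centred case applies to [re_mod] and [im_mod], whose one-sided limits at
    [x] are those of [f] times [cos(ax)] and [- sin(ax)]. Multiplying by
    [e^(iax)] turns them back into the limits of [f]. *)
Lemma fourier_inversion_annulus (x fl fr : R) :
  filterlim f (at_left x) (locally fl) -> filterlim f (at_right x) (locally fr) ->
  is_lim_RInt_annulus (fun s => Cmult (expi (x * s)) (fourier f s)) a (RtoC (PI * (fl + fr))).
Proof.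
  intros Hl Hr.
  assert (Hcont_cos : continuous (fun t => cos (- (a * t))) x)
    by (apply (ex_derive_continuous (fun t => cos (- (a * t)))); auto_derive; exact I).
  assert (Hcont_sin : continuous (fun t => sin (- (a * t))) x)
    by (apply (ex_derive_continuous (fun t => sin (- (a * t)))); auto_derive; exact I).
  assert (Hle : filter_le (at_left x) (locally x)) by apply filter_le_within.
  assert (Hri : filter_le (at_right x) (locally x)) by apply filter_le_within.
  assert (Rel := one_sided_mult f _ (fun t => cos (- (a * t))) x fl Hle Hcont_cos Hl).
  assert (Rer := one_sided_mult f _ (fun t => cos (- (a * t))) x fr Hri Hcont_cos Hr).
  assert (Iml := one_sided_mult f _ (fun t => sin (- (a * t))) x fl Hle Hcont_sin Hl).
  assert (Imr := one_sided_mult f _ (fun t => sin (- (a * t))) x fr Hri Hcont_sin Hr).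
  set (c := cos (- (a * x))) in *. set (d := sin (- (a * x))) in *.
  apply (filterlimi_locally (U := C_R_NormedModule)). intros eps.
  assert (Heps := cond_pos eps).
  destruct (cos_part_inversion re_mod V M) with (x := x) (fl := fl * c) (fr := fr * c) (eps := eps / 3)
    as (S1 & T1 & HS1 & HT1 & H1);
    [exact Hre|exact HV|apply re_mod_vanishes, Hm|apply re_mod_vanishes, Hp
    |exact Rel|exact Rer|lra|].
  destruct (cos_part_inversion im_mod V M) with (x := x) (fl := fl * d) (fr := fr * d) (eps := eps / 3)
    as (S2 & T2 & HS2 & HT2 & H2);
    [exact Him|exact HV|apply im_mod_vanishes, Hm|apply im_mod_vanishes, Hp
    |exact Iml|exact Imr|lra|].
  assert (HS0 : 0 < Rmin 1 (Rmin S1 S2)) by (repeat apply Rmin_glb_lt; lra).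
  apply Filter_prod with (fun T => Rmax 1 (Rmax T1 T2) < T)
    (fun S => 0 < S /\ S < Rmin 1 (Rmin S1 S2)).
  - exists (Rmax 1 (Rmax T1 T2)). trivial.
  - exists (mkposreal _ HS0). intros S HSb HS. change (Rabs (S - 0) < Rmin 1 (Rmin S1 S2)) in HSb.
    rewrite Rminus_0_r, Rabs_pos_eq in HSb by lra. split; assumption.
  - intros T S HT [HS HSm]. simpl.
    assert (K1 := Rmin_l 1 (Rmin S1 S2)). assert (K2 := Rmin_r 1 (Rmin S1 S2)).
    assert (K3 := Rmin_l S1 S2). assert (K4 := Rmin_r S1 S2).
    assert (L1 := Rmax_l 1 (Rmax T1 T2)). assert (L2 := Rmax_r 1 (Rmax T1 T2)).
    assert (L3 := Rmax_l T1 T2). assert (L4 := Rmax_r T1 T2).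
    assert (HST : S <= T) by lra.
    specialize (H1 S T HS ltac:(lra) ltac:(lra) HST).
    specialize (H2 S T HS ltac:(lra) ltac:(lra) HST).
    set (A := 2 * RInt (cos_part re_mod x) S T) in *.
    set (B := 2 * RInt (cos_part im_mod x) S T) in *.
    exists (Cmult (expi (a * x)) (Cplus (RtoC A) (Cmult Ci (RtoC B)))). split.
    + apply annulus_translate.
      apply annulus_ext with (fun s => Cmult (expi (a * x))
        (Cplus (Cmult (expi (x * s)) (fourier re_mod s))
               (Cmult Ci (Cmult (expi (x * s)) (fourier im_mod s)))));
        [exact HS|exact HST| |].
      * intros s Hs. rewrite fourier_modulation by exact Hs.
        replace (x * (a + s)) with (a * x + x * s) by ring.
        rewrite <- expi_mult. ring.
      * apply annulus_Cmult, annulus_plus; [|apply annulus_Cmult].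
        -- apply (centred_annulus_integral re_mod V M); auto using re_mod_vanishes.
        -- apply (centred_annulus_integral im_mod V M); auto using im_mod_vanishes.
    (* The real part of [e^(iax)] times the limit of the modulated integral; the
       imaginary part cancels. *)
    + assert (HL : PI * (fl + fr) = PI * (fl * c + fr * c) * c + PI * (fl * d + fr * d) * d).
      { assert (H := sin2_cos2 (- (a * x))). fold c d in H. unfold Rsqr in H.
        replace (PI * (fl * c + fr * c) * c + PI * (fl * d + fr * d) * d)
          with (PI * (fl + fr) * (d * d + c * c)) by ring. rewrite H. ring. }
      assert (Hc1 : Rabs c <= 1) by apply Rabs_cos_le_1.
      assert (Hd1 : Rabs d <= 1) by apply Rabs_sin_le_1.
      assert (Hb : forall p q u v, Rabs p <= 1 -> Rabs q <= 1 ->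
        Rabs u <= eps / 3 -> Rabs v <= eps / 3 -> Rabs (p * u + q * v) < eps).
      { intros p q u v Hp1 Hq1 Hu Hv. eapply Rle_lt_trans; [apply Rabs_triang|].
        rewrite !Rabs_mult.
        assert (Q1 := Rabs_pos u). assert (Q2 := Rabs_pos v). nra. }
      assert (Hexp : expi (a * x) = (c, - d)).
      { unfold expi, c, d. rewrite cos_neg, sin_neg, Ropp_involutive. reflexivity. }
      rewrite Hexp.
      set (A0 := PI * (fl * c + fr * c)) in *. set (B0 := PI * (fl * d + fr * d)) in *.
      split.
      * change (Rabs (c * (A + (0 * B - 1 * 0)) - - d * (0 + (0 * 0 + 1 * B)) - PI * (fl + fr)) < eps).
        rewrite HL.
        match goal with |- Rabs ?e < _ => replace e with (c * (A - A0) + d * (B - B0)) by ring end.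
        apply Hb; assumption.
      * change (Rabs (c * (0 + (0 * 0 + 1 * B)) + - d * (A + (0 * B - 1 * 0)) - 0) < eps).
        match goal with |- Rabs ?e < _ =>
          replace e with (c * (B - B0) + - d * (A - A0)) by (unfold A0, B0; ring) end.
        apply Hb; try assumption. rewrite Rabs_Ropp. assumption.
Qed.

End Modulation.

Lemma RtoC_mean_value (fl fr : R) :
  RtoC ((fl + fr) / 2) = Cmult (RtoC (1 / (2 * PI))) (RtoC (PI * (fl + fr))).
Proof.
  rewrite <- RtoC_mult. f_equal. field. apply PI_neq0.
Qed.

Theorem corollary3p6 (f : R -> R)
  (hbv : bounded_variation_Rbar (V := R_NormedModule) f)
  (hlim_m : is_lim f m_infty 0) (hlim_p : is_lim f p_infty 0) :
  (forall s : R, s <> 0 -> ex_fourier f s) /\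
  (forall x : R, exists (fl fr : R) (L : C),
     filterlim f (at_left x) (locally fl) /\
     filterlim f (at_right x) (locally fr) /\
     is_lim_RInt_annulus (fun s => Cmult (expi (x * s)) (fourier f s)) 0 L /\
     RtoC ((fl + fr) / 2) = Cmult (RtoC (1 / (2 * PI))) L) /\
  (forall a : R,
     bounded_variation_Rbar (V := C_R_NormedModule)
       (fun x => Cmult (expi (- (a * x))) (RtoC (f x))) ->
     forall x : R, exists (fl fr : R) (L : C),
       filterlim f (at_left x) (locally fl) /\
       filterlim f (at_right x) (locally fr) /\
       is_lim_RInt_annulus (fun s => Cmult (expi (x * s)) (fourier f s)) a L /\
       RtoC ((fl + fr) / 2) = Cmult (RtoC (1 / (2 * PI))) L).
Proof.
  destruct (bounded_variation_control (E := R_NormedModule) f hbv) as (V & M & HfV & HVM).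
  assert (Hlim : forall x, exists fl fr : R,
    filterlim f (at_left x) (locally fl) /\ filterlim f (at_right x) (locally fr)).
  { intros x. destruct (controlled_left_limit f V M x HfV HVM) as [fl Hl].
    destruct (controlled_right_limit f V M x HfV HVM) as [fr Hr].
    exists fl, fr. split; assumption. }
  assert (Hinv : forall a W K,
    (forall u v, u <= v -> Rabs (re_mod f a v - re_mod f a u) <= W v - W u) ->
    (forall u v, u <= v -> Rabs (im_mod f a v - im_mod f a u) <= W v - W u) ->
    (forall u, Rabs (W u) <= K) ->
    forall x : R, exists (fl fr : R) (L : C),
       filterlim f (at_left x) (locally fl) /\
       filterlim f (at_right x) (locally fr) /\
       is_lim_RInt_annulus (fun s => Cmult (expi (x * s)) (fourier f s)) a L /\
       RtoC ((fl + fr) / 2) = Cmult (RtoC (1 / (2 * PI))) L).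
  { intros a W K Hre Him HK x. destruct (Hlim x) as (fl & fr & Hl & Hr).
    exists fl, fr, (RtoC (PI * (fl + fr))).
    split; [exact Hl|]. split; [exact Hr|]. split; [|apply RtoC_mean_value].
    apply (fourier_inversion_annulus f W K a Hre Him HK hlim_m hlim_p); assumption. }
  split; [|split].
  - intros s Hs. apply (ex_fourier_nonzero f V M); assumption.
  - apply (Hinv 0 V M); [| |exact HVM].
    + intros u v Huv. unfold re_mod. rewrite !Rmult_0_l, Ropp_0, cos_0, !Rmult_1_r.
      apply HfV, Huv.
    + intros u v Huv. unfold im_mod. rewrite !Rmult_0_l, Ropp_0, sin_0, !Rmult_0_r, Rminus_diag, Rabs_R0.
      assert (H := HfV u v Huv).
      apply Rle_trans with (2 := H). apply norm_ge_0.
  - intros a Ha.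
    destruct (bounded_variation_control (E := C_R_NormedModule) _ Ha) as (W & K & HW & HK).
    assert (Hcomp : forall u v, u <= v -> Rabs (re_mod f a v - re_mod f a u) <= W v - W u /\
      Rabs (im_mod f a v - im_mod f a u) <= W v - W u).
    { intros u v Huv. specialize (HW u v Huv). rewrite !expi_mult_RtoC in HW.
      set (z := (re_mod f a v - re_mod f a u, im_mod f a v - im_mod f a u) : C).
      change (sqrt (Rabs (fst z) ^ 2 + Rabs (snd z) ^ 2) <= W v - W u) in HW.
      assert (H := proj1 (sqrt_plus_sqr (Rabs (fst z)) (Rabs (snd z)))).
      rewrite !Rabs_Rabsolu in H.
      assert (H1 := Rmax_l (Rabs (fst z)) (Rabs (snd z))).
      assert (H2 := Rmax_r (Rabs (fst z)) (Rabs (snd z))).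
      split; [change (Rabs (fst z) <= W v - W u)|change (Rabs (snd z) <= W v - W u)]; lra. }
    apply (Hinv a W K); [intros u v Huv; apply Hcomp, Huv..|exact HK].
Qed.
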